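(* Let $K\subset\mathbb{C}$ be a compactum, let $\sim$ be the Schönflies equivalence on $K$, let $\mathcal{D}_K=\{[x]:x\in K\}$ be the decomposition of $K$ into the equivalence classes of $\sim$, and let $\pi:K\to\mathcal{D}_K$, $\pi(x)=[x]$, be the natural projection. If $f:K\to Y$ is a monotone map onto a Peano compactum $Y$, then there is an onto map $g:\mathcal{D}_K\to Y$ with $f=g\circ\pi$.
   Context: A compactum is a compact metric space; a continuum is a connected compactum; a Peano continuum is a locally connected continuum. A Peano compactum is a compact metric space all of whose components are Peano continua and such that for every $C>0$ all but finitely many of its components have diameter less than $C$. A monotone map between compacta is a continuous onto map such that the preimage of every point is connected. For two disjoint simple closed curves $J_1,J_2\subset\hat{\mathbb{C}}$, $U(J_1,J_2)$ denotes the component of $\hat{\mathbb{C}}\setminus(J_1\cup J_2)$ whose boundary equals $J_1\cup J_2$ (an open annulus in the extended plane). The Schönflies relation $R_K$ on a compactum $K\subset\mathbb{C}$ is defined as follows: $x,y\in K$ are related under $R_K$ if either $x=y$ or there exist two disjoint simple closed curves $J_1\ni x$ and $J_2\ni y$ such that $\overline{U(J_1,J_2)}\cap K$ contains an infinite sequence of (distinct) components $Q_n$, each intersecting both $J_1$ and $J_2$, whose limit $\lim_{n\to\infty}Q_n$ under Hausdorff distance exists and contains $\{x,y\}$. The Schönflies equivalence $\sim$ on $K$ is the smallest equivalence relation on $K$ that is closed as a subset of $K\times K$ and contains $R_K$. The set $\mathcal{D}_K$ carries the quotient topology. *)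

(* Defs.v *)
From HB Require Import structures.
From mathcomp Require Import all_boot all_order all_algebra generic_quotient.
From mathcomp Require Import all_classical all_reals all_analysis.
Import Order.TTheory GRing.Theory Num.Theory.
Import numFieldTopology.Exports numFieldNormedType.Exports.

Set Implicit Arguments.
Unset Strict Implicit.
Unset Printing Implicit Defensive.

Local Open Scope classical_set_scope.
Local Open Scope ring_scope.
Local Open Scope quotient_scope.

Section Topology.

Definition components (T : topologicalType) (A : set T) : set (set T) :=
  connected_component A @` A.

Definition boundary (T : topologicalType) (A : set T) : set T :=
  closure A `\` interior A.

Definition locally_connected (T : topologicalType) : Prop :=
  forall (x : T) (U : set T), nbhs x U ->
    exists V : set T, [/\ open V, connected V, V x & V `<=` U].

(* Compactness of domain and codomain is left to the context. *)
Definition monotone_map (S T : topologicalType) (f : S -> T) : Prop :=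
  [/\ continuous f, range f = [set: T]
    & forall y : T, connected (f @^-1` [set y])].

End Topology.

Section Peano.
Context (R : realType).

Definition diam (Y : metricType R) (A : set Y) : \bar R :=
  ereal_sup [set (mdist p.1 p.2)%:E | p in A `*` A].

(* [A : Type] carries the subspace topology. *)
Definition peano_continuum (Y : metricType R) (A : set Y) : Prop :=
  [/\ compact A, connected A & locally_connected (A : Type)].

Definition peano_compactum (Y : metricType R) : Prop :=
  [/\ compact [set: Y],
      forall Q, components [set: Y] Q -> peano_continuum Q
    & forall C : R, 0 < C ->
        finite_set [set Q | components [set: Y] Q /\ ~ (diam Q < C%:E)%E]].

End Peano.

Section Schonflies.
Context (R : realType).

(* The complex plane; its multiplication plays no role here. *)
Definition plane : topologicalType := (R * R)%type.

Definition sphere : topologicalType := one_point_compactification plane.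

Definition to_sphere (z : plane) : sphere := Some z.

Definition edist (z w : plane) : R :=
  Num.sqrt ((z.1 - w.1) ^+ 2 + (z.2 - w.2) ^+ 2).

Definition hausdorff_dist (A B : set plane) : \bar R :=
  Order.max
    (ereal_sup [set ereal_inf [set (edist a b)%:E | b in B] | a in A])
    (ereal_sup [set ereal_inf [set (edist a b)%:E | a in A] | b in B]).

Definition simple_closed_curve (J : set sphere) : Prop :=
  exists gamma : R -> sphere,
    [/\ {within `[0, 1], continuous gamma}, gamma 0 = gamma 1,
        {in `[0, 1[ &, injective gamma} & J = gamma @` `[0, 1]].

(* [U] is U(J1, J2); such a component is unique. *)
Definition annulus (J1 J2 U : set sphere) : Prop :=
  components (~` (J1 `|` J2)) U /\ boundary U = J1 `|` J2.

Definition schonflies_rel (K : set plane) (x y : K) : Prop :=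
  x = y \/
  exists J1 J2 U : set sphere,
    [/\ simple_closed_curve J1 /\ simple_closed_curve J2,
        J1 `&` J2 = set0,
        J1 (to_sphere (set_val x)) /\ J2 (to_sphere (set_val y)),
        annulus J1 J2 U
      & exists (Q : nat -> set plane) (L : set plane),
        [/\ injective Q,
            forall n, components (to_sphere @^-1` closure U `&` K) (Q n),
            forall n, Q n `&` to_sphere @^-1` J1 !=set0 /\
                      Q n `&` to_sphere @^-1` J2 !=set0,
            compact L /\
              hausdorff_dist (Q n) L @[n --> \oo] --> 0%E
          & L (set_val x) /\ L (set_val y)]].

Definition schonflies_eq (K : set plane) (x y : K) : bool :=
  `[< forall E : equiv_rel K,
        closed [set p : K * K | E p.1 p.2] ->
        (forall a b : K, schonflies_rel a b -> E a b) ->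
        E x y >].

Lemma schonflies_eq_equiv (K : set plane) :
  equiv_class_of (@schonflies_eq K).
Proof.
split=> [x|x y|y x z].
- by apply/asboolP => E _ _; exact: (generic_quotient.equiv_refl E).
- by apply/asboolP/asboolP => xy E cE sE; rewrite generic_quotient.equiv_sym; exact: xy.
- move=> /asboolP xy /asboolP yz; apply/asboolP => E cE sE.
  exact: (generic_quotient.equiv_trans (xy E cE sE) (yz E cE sE)).
Qed.

Canonical schonflies_equiv (K : set plane) : equiv_rel K :=
  EquivRelPack (schonflies_eq_equiv K).

Lemma schonflies_eq_closed (K : set plane) :
  closed [set p : K * K | schonflies_equiv K p.1 p.2].
Proof.
rewrite (_ : [set p | _] =
  \bigcap_(E in [set E : equiv_rel K | closed [set p : K * K | E p.1 p.2] /\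
     forall a b : K, schonflies_rel a b -> E a b])
  [set p : K * K | E p.1 p.2]); first by apply: closed_bigI => E [].
apply/seteqP; split=> p /=.
  by move=> /asboolP h E [cE sE]; exact: h.
by move=> h; apply/asboolP => E cE sE; exact: (h E).
Qed.

Lemma schonflies_eq_rel (K : set plane) (x y : K) :
  schonflies_rel x y -> schonflies_equiv K x y.
Proof. by move=> xy; apply/asboolP => E _; apply. Qed.

Lemma schonflies_eq_min (K : set plane) (E : equiv_rel K) :
  closed [set p : K * K | E p.1 p.2] ->
  (forall a b : K, schonflies_rel a b -> E a b) ->
  forall x y, schonflies_equiv K x y -> E x y.
Proof. by move=> cE sE x y /asboolP; apply. Qed.

Definition schonflies_quotient (K : set plane) : topologicalType :=
  quotient_topology {eq_quot schonflies_equiv K}.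

Definition schonflies_pi (K : set plane) (x : K) : schonflies_quotient K :=
  \pi_(quotient_topology {eq_quot schonflies_equiv K}) x.

End Schonflies.

(* Main.v *)
(** Suppose that [x] and [y] are related through [J1], [J2], [U] and components
    [Q n] with limit [L], but [f x <> f y].  Take five points [z] of [L] whose
    images have distinct distances to [f x].  A small connected neighbourhood of
    [f z] has a connected preimage, which meets all late [Q n]; to pass from one
    component of [closure U `&` K] to another it must leave [U], and this forces
    each late [Q n] to contain a point of [J1 `|` J2] whose image is close to
    [f z].  By the pigeonhole principle two disjoint [Q n] and [Q m], lying on the
    same side of one of the two curves, both visit three disjoint arcs of that
    curve.  This is impossible: disjoint continua in a closed Jordan domain cannot
    meet the boundary curve in interleaved pairs of points.

    The planar topology rests on Eilenberg's criterion: a compact set does not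
    separate [p] from [q] if and only if [(z - p) / (z - q)] has a continuous
    logarithm on it.  Logarithms on two closed sets with connected intersection
    glue (Janiszewski's theorem), which yields that a Jordan curve separates the
    plane, that arcs do not, and the statement on interleaved pairs. *)

Require Import Defs.
From mathcomp Require Import all_boot all_order all_algebra generic_quotient.
From mathcomp Require Import lra.
From mathcomp Require Import all_classical all_reals all_analysis.
Import Order.TTheory GRing.Theory Num.Theory.
Import numFieldTopology.Exports numFieldNormedType.Exports.

Set Implicit Arguments.
Unset Strict Implicit.
Unset Printing Implicit Defensive.

Local Open Scope classical_set_scope.
Local Open Scope ring_scope.

(** * Continuous arguments of maps into the plane *)

Section Rotations.
Context {R : realType}.
Implicit Types (s t r : R) (u v w : R * R).

(** Why three visits per continuum: two pairs of points on a curve may be nested instead of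
    interleaved, but among three successive pairs two are ordered alike, hence interleaved. With two
    boundary curves, five points of [L] force three onto one of them.

    Distances to [f x] reduce the choice of arcs to one real function. It is uniformly continuous
    along the part of each curve in [K], so points with well separated values fall into different
    cells of a fine subdivision of the parameter interval. Only finitely many patterns of curves and
    cells exist, so two components share a pattern.

    The curves live on the sphere and may pass through infinity, whereas winding belongs to the
    plane. Inversion about a point of [U] off the two continua brings curve and continua into the
    plane and keeps the continua off a bounded complementary domain of the image curve. The angles
    are then based at a point of that domain, whose closure contains the whole curve. *)

Definition rot t v : R * R :=
  (cos t * v.1 - sin t * v.2, sin t * v.1 + cos t * v.2).

Definition dot u v := u.1 * v.1 + u.2 * v.2.

Definition wedge u v := u.1 * v.2 - u.2 * v.1.

(** For nonzero [v], [t] is an argument of the complex quotient [w / v]. The modulus is dropped,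
    since only arguments have to be chosen continuously. *)
Definition turn t v w :=
  exists2 r, 0 < r & w.1 = r * (rot t v).1 /\ w.2 = r * (rot t v).2.

Lemma turn0 v : turn 0 v v.
Proof. by exists 1 => //; rewrite /rot /= cos0 sin0; split; lra. Qed.

Lemma turnD s t u v w : turn s u v -> turn t v w -> turn (s + t) u w.
Proof.
case=> r r0 [v1 v2] [q q0 [w1 w2]]; exists (q * r); first exact: mulr_gt0.
by rewrite w1 w2 /rot /= v1 v2 /rot /= cosD sinD; split; lra.
Qed.

Lemma turnN t u v : turn t u v -> turn (- t) v u.
Proof.
case=> r r0 [v1 v2]; have rn0 : r != 0 by rewrite gt_eqF.
exists r^-1; first by rewrite invr_gt0.
rewrite /rot /= v1 v2 /rot /= cosN sinN; have := cos2Dsin2 t.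
set c := cos t; set s := sin t => cs.
have -> : r^-1 * (c * (r * (c * u.1 - s * u.2)) - - s * (r * (s * u.1 + c * u.2)))
  = (r^-1 * r) * ((c ^+ 2 + s ^+ 2) * u.1) by lra.
have -> : r^-1 * (- s * (r * (c * u.1 - s * u.2)) + c * (r * (s * u.1 + c * u.2)))
  = (r^-1 * r) * ((c ^+ 2 + s ^+ 2) * u.2) by lra.
by rewrite cs mulVf // !mul1r.
Qed.

Lemma dot_gt0 v : v != 0 -> 0 < dot v v.
Proof.
move=> v0; rewrite lt_neqAle addr_ge0 ?andbT -?expr2 ?sqr_ge0 //.
apply: contra v0; rewrite eq_sym /dot -!expr2 paddr_eq0 ?sqr_ge0 // !sqrf_eq0.
by case: v => a b /= /andP[/eqP -> /eqP ->].
Qed.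

(** Pairing both equations with [v] by [dot] and [wedge] gives r cos t = 1 and r sin t = 0;
    positivity of [r] rules out cos t = -1. *)
Lemma turn_id t v : v != 0 -> turn t v v -> cos t = 1.
Proof.
move=> /dot_gt0; rewrite /dot => v0 [r r0 []]; rewrite /rot /=.
set c := cos t; set s := sin t => v1 v2.
have cs : c ^+ 2 + s ^+ 2 = 1 by rewrite cos2Dsin2.
have e1 : (v.1 * v.1 + v.2 * v.2) * (1 - r * c) = 0.
  have : v.1 * v.1 + v.2 * v.2 =
     v.1 * (r * (c * v.1 - s * v.2)) + v.2 * (r * (s * v.1 + c * v.2)).
    by rewrite -v1 -v2.
  move=> e; have -> : (v.1 * v.1 + v.2 * v.2) * (1 - r * c) =
    (v.1 * v.1 + v.2 * v.2) -
    (v.1 * (r * (c * v.1 - s * v.2)) + v.2 * (r * (s * v.1 + c * v.2))) by lra.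
  by rewrite -e subrr.
have e2 : (v.1 * v.1 + v.2 * v.2) * (r * s) = 0.
  have : v.1 * v.2 - v.2 * v.1 =
     v.1 * (r * (s * v.1 + c * v.2)) - v.2 * (r * (c * v.1 - s * v.2)).
    by rewrite -v1 -v2.
  move=> e; have -> : (v.1 * v.1 + v.2 * v.2) * (r * s) =
    v.1 * (r * (s * v.1 + c * v.2)) - v.2 * (r * (c * v.1 - s * v.2)) by lra.
  by rewrite -e; lra.
have rc : r * c = 1.
  by move/eqP: e1; rewrite mulf_eq0 gt_eqF //= subr_eq0 => /eqP.
have s0 : s = 0.
  by move/eqP: e2; rewrite !mulf_eq0 gt_eqF //= gt_eqF //= => /eqP.
have c0 : 0 < c by rewrite -(pmulr_rgt0 _ r0) rc.
move: cs; rewrite s0 expr0n addr0 => /eqP; rewrite sqrf_eq1 => /orP[/eqP //|/eqP c1].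
by move: c0; rewrite c1 oppr_gt0 ltr10.
Qed.

(* [u v^*] has positive real part [dot v u], hence argument [atan] of its slope. *)
Lemma turn_atan u v : 0 < dot v u -> turn (atan (wedge v u / dot v u)) v u.
Proof.
move=> d0; set t := wedge v u / dot v u.
have dn : dot v u != 0 by rewrite gt_eqF.
have v0 : 0 < dot v v.
  apply: dot_gt0; apply: contraTneq d0 => ->.
  by rewrite /dot /= !mul0r addr0 ltxx.
have vn : dot v v != 0 by rewrite gt_eqF.
have q0 : 0 < Num.sqrt (1 + t ^+ 2).
  by rewrite sqrtr_gt0 ltr_wpDr ?sqr_ge0.
have sE : sin (atan t) = t * (Num.sqrt (1 + t ^+ 2))^-1.
  have := atanK t; rewrite /tan cos_atan.
  move/(congr1 (fun x => x * (Num.sqrt (1 + t ^+ 2))^-1)) => <-.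
  by rewrite mulfVK // invr_eq0 gt_eqF.
exists (dot v u / dot v v * Num.sqrt (1 + t ^+ 2)).
  by rewrite mulr_gt0 // divr_gt0.
rewrite /rot /= sE cos_atan.
have q1 : Num.sqrt (1 + t ^+ 2) != 0 by rewrite gt_eqF.
move: (Num.sqrt _) q1 => q q1; rewrite /t; clear t sE q0.
have k1 a : dot v u / dot v v * q * (q^-1 * a.1 - wedge v u / dot v u * q^-1 * a.2) =
   (dot v u * a.1 - wedge v u * a.2) / dot v v.
  transitivity ((q * q^-1) * (dot v u * a.1 - (dot v u / dot v u) * wedge v u * a.2) / dot v v).
    by lra.
  by rewrite !mulfV // !mul1r.
have k2 a : dot v u / dot v v * q * (wedge v u / dot v u * q^-1 * a.1 + q^-1 * a.2) =
   (wedge v u * a.1 + dot v u * a.2) / dot v v.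
  transitivity ((q * q^-1) * ((dot v u / dot v u) * wedge v u * a.1 + dot v u * a.2) / dot v v).
    by lra.
  by rewrite !mulfV // !mul1r.
rewrite k1 k2; split; apply: (mulIf vn); rewrite mulfVK // /dot /wedge; lra.
Qed.

Lemma cos_lt1 t : 0 < t < pi -> cos t < 1.
Proof.
move=> tpi; have s0 := sin_gt0_pi tpi.
rewrite lt_neqAle cos_le1 andbT; apply/eqP => c1.
by move: s0; rewrite cos1sin0 ?ltxx // c1 normr1.
Qed.

End Rotations.

Section AngleFunctions.
Context {R : realType} {T : topologicalType}.
Implicit Types (X : set T) (F G H : T -> R * R).

(* Identifying [R * R] with the complex numbers: [F / G] has a continuous
   argument on [X]. *)
Definition homotopic_dir X F G :=
  exists2 a : T -> R, {within X, continuous a} &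
    forall z, X z -> turn (a z) (G z) (F z).

Lemma hdir_refl X F : homotopic_dir X F F.
Proof. by exists (fun=> 0); [move=> ?; exact: cvg_cst | move=> z _; exact: turn0]. Qed.

Lemma hdir_sym X F G : homotopic_dir X F G -> homotopic_dir X G F.
Proof.
case=> a ca aP; exists (fun z => - a z) => [z|z Xz]; last exact/turnN/aP.
by apply: cvgN; exact: ca.
Qed.

Lemma hdir_trans X F G H :
  homotopic_dir X F G -> homotopic_dir X G H -> homotopic_dir X F H.
Proof.
case=> a ca aP [b cb bP]; exists (fun z => b z + a z) => [z|z Xz].
  by apply: cvgD; [exact: cb|exact: ca].
exact: turnD (bP z Xz) (aP z Xz).
Qed.

Lemma hdir_sub X X' F G : X' `<=` X -> homotopic_dir X F G -> homotopic_dir X' F G.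
Proof.
move=> XX [a ca aP]; exists a; first exact: continuous_subspaceW ca.
by move=> z /XX/aP.
Qed.

Lemma hdir_eq X F G F' G' : {in X, F =1 F'} -> {in X, G =1 G'} ->
  homotopic_dir X F G -> homotopic_dir X F' G'.
Proof.
move=> FF GG [a ca aP]; exists a => // z Xz.
by rewrite -FF ?inE // -GG ?inE //; exact: aP.
Qed.

(** Directions at an acute angle have the arctangent of the slope as a canonical, hence continuous,
    angle between them. *)
Lemma hdir_dot X F G : {within X, continuous F} -> {within X, continuous G} ->
  (forall z, X z -> 0 < dot (G z) (F z)) -> homotopic_dir X F G.
Proof.
move=> cF cG FG; exists (fun z => atan (wedge (G z) (F z) / dot (G z) (F z))).
  apply/subspace_continuousP => z Xz.
  have cf : F @ within X (nbhs z) --> F z by move/subspace_continuousP: cF; exact.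
  have cg : G @ within X (nbhs z) --> G z by move/subspace_continuousP: cG; exact.
  have f1 : (F x).1 @[x --> within X (nbhs z)] --> (F z).1.
    by apply: (cvg_comp _ _ cf); exact: cvg_fst.
  have f2 : (F x).2 @[x --> within X (nbhs z)] --> (F z).2.
    by apply: (cvg_comp _ _ cf); exact: cvg_snd.
  have g1 : (G x).1 @[x --> within X (nbhs z)] --> (G z).1.
    by apply: (cvg_comp _ _ cg); exact: cvg_fst.
  have g2 : (G x).2 @[x --> within X (nbhs z)] --> (G z).2.
    by apply: (cvg_comp _ _ cg); exact: cvg_snd.
  apply: (@cvg_comp _ _ _ (fun x => wedge (G x) (F x) / dot (G x) (F x)) atan);
    last exact: continuous_atan.
  apply: cvgM; first by apply: cvgB; apply: cvgM.
  apply: cvgV; first by rewrite gt_eqF // FG.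
  by apply: cvgD; apply: cvgM.
by move=> z Xz; exact/turn_atan/FG.
Qed.

(** The values of [a] form an interval, and a value exceeding another by less than pi would have
    cosine below 1. *)
Lemma cos1_const X (a : T -> R) : connected X -> {within X, continuous a} ->
  (forall z, X z -> cos (a z) = 1) -> forall y z, X y -> X z -> a y = a z.
Proof.
move=> cX ca a1.
suff aux y z : X y -> X z -> ~ a y < a z.
  by move=> y z Xy Xz; apply/eqP; rewrite eq_le !leNgt; apply/andP; split; apply/negP; exact: aux.
move=> Xy Xz yz; have pi0 := pi_gt0 R.
have /connected_intervalP iP : connected (a @` X).
  exact: connected_continuous_connected.
pose e := Num.min (a z - a y) (pi / 2).
have e0 : 0 < e by rewrite lt_min subr_gt0 yz divr_gt0.
have epi : e < pi by rewrite gt_min ltr_pdivrMr // ltr_pMr // ltr1n orbT.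
have [x Xx xE] : (a @` X) (a y + e).
  apply: (iP (a y) (a z)); [by exists y|by exists z|].
  rewrite lerDl ltW //= -lerBrDl /e ge_min lexx //.
have := a1 _ Xx; rewrite xE cosD a1 // mul1r.
have -> : sin (a y) = 0 by apply: cos1sin0; rewrite a1 // normr1.
rewrite mul0r subr0 => ce; have := @cos_lt1 R e; rewrite ce ltxx e0 epi.
by move/(_ isT).
Qed.

(** On the intersection two arguments of one quotient differ by a multiple of 2 pi, which
    connectedness makes constant; shifting the second argument by it makes the two agree. *)
Lemma hdir_glue X Y F G : closed X -> closed Y -> connected (X `&` Y) ->
    X `&` Y !=set0 -> (forall z, (X `&` Y) z -> G z != 0) ->
  homotopic_dir X F G -> homotopic_dir Y F G -> homotopic_dir (X `|` Y) F G.
Proof.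
move=> clX clY cXY [p XYp] G0 [a ca aP] [b cb bP].
have ab z : (X `&` Y) z -> cos (a z - b z) = 1.
  move=> XYz; apply: (turn_id (G0 _ XYz)).
  exact: turnD (aP _ XYz.1) (turnN (bP _ XYz.2)).
have c z : (X `&` Y) z -> a z - b z = a p - b p.
  move=> XYz; apply: (@cos1_const (X `&` Y) (fun x => a x - b x)) => //.
  by move=> x; apply: cvgB;
    [apply: (continuous_subspaceW _ ca)|apply: (continuous_subspaceW _ cb)] => ? [].
pose k := a p - b p.
exists (fun z => if z \in X then a z else b z + k).
  apply: withinU_continuous => //.
    by apply: subspace_eq_continuous ca => z zX; rewrite /from_subspace zX.
  have : {within Y, continuous (fun z => b z + k)}.
    by move=> x; apply: cvgD; [exact: cb|exact: cvg_cst].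
  apply: subspace_eq_continuous => z zY; rewrite /from_subspace.
  case: ifPn => // zX; rewrite /k -(c z) ?subrKC //.
  by rewrite !inE in zX zY.
move=> z XYz; case: ifPn => [/set_mem|]; first exact: aP.
move=> zX; have Yz : Y z by case: XYz => // Xz; rewrite mem_set in zX.
have : turn k (F z) (F z); last by apply: turnD; exact: bP.
have : cos k = 1 by exact: ab.
move=> ck; exists 1 => //; rewrite /rot /= ck (_ : sin k = 0) ?cos1sin0 ?ck ?normr1 //.
by split; lra.
Qed.

End AngleFunctions.

(** * Separation in the plane *)

Lemma within_comp_continuous {S T U : topologicalType} (A : set S) (B : set T)
    (f : S -> T) (g : T -> U) :
  {within A, continuous f} -> {within B, continuous g} -> f @` A `<=` B ->
  {within A, continuous (g \o f)}.
Proof.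
move=> /subspace_continuousP cf /subspace_continuousP cg fAB.
apply/subspace_continuousP => x Ax W /= Wgf.
have Bfx : B (f x) by apply: fAB; exists x.
have /(cf x Ax) := cg _ Bfx W Wgf.
rewrite !nbhs_simpl /= /within /=; apply: filterS => y /= h Ay.
by apply: h => //; apply: fAB; exists y.
Qed.

(** Subdivision into short pieces, as real induction: the supremum of the [t] with [P u t] can be
    reached from the left and then passed, unless it is [v]. *)
Lemma cousin {R : realType} (P : R -> R -> Prop) (u v : R) : u <= v ->
  (forall s t r, u <= s -> s <= t -> t <= r -> r <= v ->
    P s t -> P t r -> P s r) ->
  (forall t, u <= t <= v -> exists2 e, 0 < e &
    forall s r, u <= s -> s <= r -> r <= v -> t - e < s -> r < t + e -> P s r) ->
  P u v.
Proof.
move=> uv Ptrans Ploc; pose S := [set t | u <= t <= v /\ P u t].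
have Su : S u.
  split; first by rewrite lexx.
  have [|e e0] := Ploc u; first by rewrite lexx.
  by apply => //; rewrite ?lexx //; lra.
have Sv : ubound S v by move=> t [/andP[]].
have supS : has_sup S by split; [exists u|exists v].
have us : u <= sup S by apply: ub_le_sup Su; exists v.
have sv : sup S <= v by apply: ge_sup => //; exists u.
have [|e e0 loc] := Ploc (sup S); first by rewrite us.
have [t [/andP[ut tv] Put] st] := sup_adherent e0 supS.
have tS : t <= sup S by apply: ub_le_sup; [exists v|split => //; rewrite ut].
pose s' := Num.min v (sup S + e / 2).
have s'v : s' <= v by rewrite ge_min lexx.
have s'e : s' < sup S + e.
  by rewrite gt_min; apply/orP; right; lra.
have ss' : sup S <= s' by rewrite le_min sv /=; lra.
have Pus' : P u s'.
  by apply: (Ptrans u t s') => //; [lra|apply: loc => //; lra].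
have : s' <= sup S by apply: ub_le_sup; [exists v|split => //; rewrite s'v; lra].
rewrite ge_min => /orP[vs|]; last by lra.
by have -> : v = s' by rewrite /s'; apply/esym/min_idPl; lra.
Qed.

Section PlaneWinding.
Context {R : realType}.
Implicit Types (X : set (R * R)) (p q u v w z : R * R).

(* Eilenberg's criterion: for compact [X] this means that [X] does not separate
   [p] from [q]. *)
Definition linked X p q := homotopic_dir X (fun z => z - p) (fun z => z - q).

Lemma linkedC X p q : linked X p q -> linked X q p.
Proof. exact: hdir_sym. Qed.

Lemma linked_trans X p q r : linked X p q -> linked X q r -> linked X p r.
Proof. exact: hdir_trans. Qed.

Lemma continuous_subl p : continuous (fun z => z - p).
Proof. by move=> z; apply: cvgB; [exact: cvg_id|exact: cvg_cst]. Qed.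

Lemma nbhs_box p (U : set (R * R)) : nbhs p U <->
  exists2 e, 0 < e & forall q, `|q.1 - p.1| < e -> `|q.2 - p.2| < e -> U q.
Proof.
split.
  move=> /nbhs_ballP[e /= e0 eU]; exists e => // q q1 q2; apply: eU.
  by split; rewrite /ball /= distrC.
case=> e e0 eU; apply/nbhs_ballP; exists e => //= q [q1 q2].
by apply: eU; rewrite distrC.
Qed.

(** Moving the pole by less than a quarter of its distance from [X] keeps [z - p] and [z - q] at an
    acute angle for all [z] in [X]. *)
Lemma linked_near X p : closed X -> ~ X p -> \forall q \near p, linked X q p.
Proof.
move=> clX nXp; have /nbhs_box[e e0 eX] : nbhs p (~` X).
  by apply: open_nbhs_nbhs; split => //; exact: closed_openC.
apply/nbhs_box; exists (e / 4); first by rewrite divr_gt0.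
move=> q q1 q2; apply: hdir_dot.
- exact/continuous_subspaceT/continuous_subl.
- exact/continuous_subspaceT/continuous_subl.
move=> z Xz; rewrite /dot /=.
have : e <= `|z.1 - p.1| \/ e <= `|z.2 - p.2|.
  case: (ltP `|z.1 - p.1| e) => z1; last by left.
  by case: (ltP `|z.2 - p.2| e) => z2; [case: (eX z)|right].
move: q1 q2; rewrite !ltr_norml => /andP[q1 q1'] /andP[q2 q2'].
move: q1 q1' q2 q2'.
set a := z.1 - p.1; set b := z.2 - p.2; set c := q.1 - p.1; set d := q.2 - p.2.
have -> : z.1 - q.1 = a - c by rewrite /a /c; lra.
have -> : z.2 - q.2 = b - d by rewrite /b /d; lra.
move: a b c d => a b c d c1 c2 d1 d2.
(* The coordinate of size at least [e] contributes at least 3/4 of e^2, and the other one loses at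
   most 1/64 of it. *)
have sq (x y : R) : - (e / 4) < y -> y < e / 4 -> - e ^+ 2 <= 64 * (x * (x - y)).
  by move=> y1 y2; have := sqr_ge0 (2 * x - y); nra.
have lin (x y : R) : - (e / 4) < y -> y < e / 4 -> e <= `|x| ->
    3 * e ^+ 2 <= 4 * (x * (x - y)).
  by move=> y1 y2; rewrite ler_normr => /orP[] ?; nra.
have ee : 0 < e ^+ 2 by rewrite exprn_gt0.
by case=> h; [have := lin _ _ c1 c2 h; have := sq b d d1 d2
  |have := lin _ _ d1 d2 h; have := sq a c c1 c2]; lra.
Qed.

(** The easy half of Eilenberg's criterion: classes of linked points off [X] are open, so the class
    of [p] is relatively clopen in [C]. *)
Lemma linked_connected X C p q : closed X -> connected C -> C `&` X = set0 ->
  C p -> C q -> linked X p q.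
Proof.
move=> clX cC CX Cp Cq; pose B := [set z | C z /\ linked X p z].
suff BC : B = C by have [] : B q by rewrite BC.
have nX z : C z -> ~ X z.
  by move=> Cz Xz; have : set0 z by rewrite -CX.
pose lnk z := [set w | ~ X w /\ linked X z w].
have olnk z : open (lnk z).
  rewrite openE => w [nXw zw]; rewrite /interior.
  have nw : \forall v \near w, ~ X v.
    by apply: open_nbhs_nbhs; split => //; exact: closed_openC.
  near=> v; split; first by near: v.
  by apply: linked_trans zw _; apply: linkedC; near: v; exact: linked_near.
apply: cC; first by exists p; split => //; exact: hdir_refl.
  exists (lnk p) => //; apply/seteqP; split=> z [] => [Cz pz|Cz [_ pz]] //.
  by split => //; split => //; exact: nX.
exists (~` \bigcup_(z in [set z | ~ linked X p z]) lnk z).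
  by apply: open_closedC; apply: bigcup_open => z _.
apply/seteqP; split=> z [] => [Cz pz|Cz npz].
  split => // -[w /= npw [_ wz]]; apply: npw.
  exact: linked_trans pz (linkedC wz).
split => //; apply: contrapT => npz'; apply: npz; exists z => //.
by split; [exact: nX|exact: hdir_refl].
Unshelve. all: by end_near. Qed.

Lemma linked_glue X Y p q : closed X -> closed Y -> connected (X `&` Y) ->
    X `&` Y !=set0 -> ~ (X `&` Y) q ->
  linked X p q -> linked Y p q -> linked (X `|` Y) p q.
Proof.
move=> clX clY cXY XY0 nq; apply: hdir_glue => // z XYz.
by rewrite subr_eq0; apply: contra_not_neq nq => <-.
Qed.

Lemma cvg_coords (T : topologicalType) (F : set_system T) (FF : Filter F)
    (f : T -> R * R) (v : R * R) : f @ F --> v <->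
  (f x).1 @[x --> F] --> v.1 /\ (f x).2 @[x --> F] --> v.2.
Proof.
split=> [cf|[c1 c2]].
  by split; apply: (cvg_comp _ _ cf); [exact: cvg_fst|exact: cvg_snd].
have : ((f x).1, (f x).2) @[x --> F] --> (v.1, v.2).
  by apply: (@cvg_pair _ _ _ F (nbhs v.1) (nbhs v.2)).
by under eq_fun do rewrite -surjective_pairing; rewrite -surjective_pairing.
Qed.

Lemma rot_continuous (T : topologicalType) (F : set_system T) (FF : Filter F)
    (a : T -> R) (f : T -> R * R) t v :
  a @ F --> t -> f @ F --> v -> rot (a x) (f x) @[x --> F] --> rot t v.
Proof.
move=> ca cf.
have [f1 f2] := (cvg_coords _ _ v).1 cf.
have cc : cos (a x) @[x --> F] --> cos t.
  by apply: (@cvg_comp _ _ _ a cos _ _ _ ca); exact: continuous_cos.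
have cs : sin (a x) @[x --> F] --> sin t.
  by apply: (@cvg_comp _ _ _ a sin _ _ _ ca); exact: continuous_sin.
apply/cvg_coords; split.
  by apply: cvgB; apply: cvgM.
by apply: cvgD; apply: cvgM.
Qed.

Lemma dot_cvg (T : topologicalType) (F : set_system T) (FF : Filter F)
    (f g : T -> R * R) u v :
  f @ F --> u -> g @ F --> v -> dot (f x) (g x) @[x --> F] --> dot u v.
Proof.
move=> cf cg.
have [f1 f2] := (cvg_coords _ _ u).1 cf.
have [g1 g2] := (cvg_coords _ _ v).1 cg.
by apply: cvgD; apply: cvgM.
Qed.

Definition unit_vec (v : R * R) : R * R :=
  (v.1 / Num.sqrt (dot v v), v.2 / Num.sqrt (dot v v)).

Lemma unit_vec_cvg (T : topologicalType) (F : set_system T) (FF : Filter F)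
    (f : T -> R * R) v : v != 0 ->
  f @ F --> v -> unit_vec (f x) @[x --> F] --> unit_vec v.
Proof.
move=> v0 cf.
have [f1 f2] := (cvg_coords _ _ v).1 cf.
have cs : (Num.sqrt (dot (f x) (f x)))^-1 @[x --> F] --> (Num.sqrt (dot v v))^-1.
  apply: cvgV; first by rewrite gt_eqF // sqrtr_gt0 dot_gt0.
  apply: (@cvg_comp _ _ _ (fun x => dot (f x) (f x)) Num.sqrt F (nbhs (dot v v))).
    by apply: dot_cvg.
  exact: sqrt_continuous.
by apply/cvg_coords; split; apply: cvgM.
Qed.

Lemma turn_unit v : v != 0 -> turn 0 v (unit_vec v).
Proof.
move=> v0; exists (Num.sqrt (dot v v))^-1.
  by rewrite invr_gt0 sqrtr_gt0 dot_gt0.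
by rewrite /rot /= cos0 sin0; split; lra.
Qed.

Lemma turn_neq0 t v w : turn t v w -> v != 0 -> w != 0.
Proof.
move=> [r r0 [w1 w2]]; apply: contra_neq => w0.
have e1 : (rot t v).1 = 0.
  by move: w1; rewrite w0 /= => /esym/eqP; rewrite mulf_eq0 gt_eqF //= => /eqP.
have e2 : (rot t v).2 = 0.
  by move: w2; rewrite w0 /= => /esym/eqP; rewrite mulf_eq0 gt_eqF //= => /eqP.
have : turn t v (rot t v) by exists 1 => //; rewrite !mul1r.
move/turnN => [q q0 [v1 v2]].
move: e1 e2 v1 v2; rewrite /rot /= => -> ->; rewrite !mulr0 subr0 addr0 mulr0 => v1 v2.
by rewrite (surjective_pairing v) v1 v2.
Qed.

(** After normalisation [turn] becomes an equation, so an angle can make two formulas for one map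
    agree on their overlap. *)
Lemma turn_unit_vec t v w : v != 0 -> turn t v w ->
  unit_vec w = rot t (unit_vec v).
Proof.
move=> v0 [r r0 [w1 w2]].
suff sw : Num.sqrt (dot w w) = r * Num.sqrt (dot v v).
  have s0 : Num.sqrt (dot v v) != 0.
    by rewrite gt_eqF // sqrtr_gt0 dot_gt0.
  have rn : r != 0 by rewrite gt_eqF.
  rewrite /unit_vec sw w1 w2 /rot /=.
  have rs x : r * x / (r * Num.sqrt (dot v v)) = x / Num.sqrt (dot v v).
    by rewrite -mulf_div mulfV // mul1r.
  by rewrite !rs; congr pair; lra.
have : dot w w = r ^+ 2 * dot v v.
  rewrite /dot w1 w2 /rot /=.
  transitivity (r ^+ 2 * ((cos t ^+ 2 + sin t ^+ 2) * (v.1 * v.1 + v.2 * v.2))).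
    by lra.
  by rewrite cos2Dsin2 mul1r.
move=> ->; rewrite sqrtrM ?sqr_ge0 // sqrtr_sqr ger0_norm // ltW //.
Qed.

End PlaneWinding.

(** * Maps without zeros and the hard half of Eilenberg's criterion *)

Section PlaneSeparation.
Context {R : realType}.
Implicit Types (X : set (R * R)) (p q u v w z : R * R).

(** Scaling [z] down to 0 contracts the map to a constant. Compactness of [X] makes the angle
    between nearby stages acute at all points at once, and [cousin] composes the stages. *)
Lemma plane_map_nullhomotopic X (M : R * R -> R * R) : compact X ->
  continuous M -> (forall z, M z != 0) -> homotopic_dir X M (fun=> M 0).
Proof.
move=> cX cM M0.
pose P s t := homotopic_dir X (fun z => M (t *: z)) (fun z => M (s *: z)).
have cMs s : continuous (fun z => M (s *: z)).
  move=> z; apply: (@cvg_comp _ _ _ (fun z => s *: z) M _ (nbhs (s *: z))).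
    by apply: cvgZr; exact: cvg_id.
  exact: cM.
suff : P 0 1.
  apply: hdir_eq => z _; rewrite /= ?scale1r ?scale0r //.
apply: cousin => [|s t r _ _ _ _ Pst Ptr|t _]; first exact: ler01.
  exact: hdir_trans Ptr Pst.
pose D (sr : R * R) z := 0 < dot (M (sr.1 *: z)) (M (sr.2 *: z)).
have : \forall sr \near (t, t), X `<=` D sr.
  move/compact_near_coveringP: cX => /(_ _ (nbhs (t, t))); apply => z Xz.
  have cD : dot (M (zs.2.1 *: zs.1)) (M (zs.2.2 *: zs.1))
    @[zs --> (z, (t, t))] --> dot (M (t *: z)) (M (t *: z)).
    have cc (f : R * R -> R) : f @ (t, t) --> t ->
      M (f zs.2 *: zs.1) @[zs --> (z, (t, t))] --> M (t *: z).
      move=> cf; apply: (@cvg_comp _ _ _ (fun zs => f zs.2 *: zs.1) M _ (nbhs (t *: z))).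
        apply: cvgZ; last exact: cvg_fst.
        by apply: (@cvg_comp _ _ _ snd f _ (nbhs (t, t))); [exact: cvg_snd|].
      exact: cM.
    by apply: dot_cvg; [apply: (cc fst); exact: cvg_fst|apply: (cc snd); exact: cvg_snd].
  by apply: (cvgr_gt _ cD); exact: dot_gt0.
move=> /nbhs_box[e e0 eD]; exists e => // s r _ sr _ ts rt.
apply: hdir_dot; [exact/continuous_subspaceT/cMs|exact/continuous_subspaceT/cMs|].
by move=> z Xz; apply: (eD (s, r)) => //=; rewrite ltr_norml; lra.
Qed.

Definition circle_pt (r t : R) : R * R := (r * cos t, r * sin t).

Definition circle (r : R) := circle_pt r @` `[0, 2 * pi].

Lemma circle_pt_continuous r : continuous (circle_pt r).
Proof.
by move=> t; apply/cvg_coords; split; apply: cvgM;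
  [exact: cvg_cst|exact: continuous_cos|exact: cvg_cst|exact: continuous_sin].
Qed.

Lemma circle_compact r : compact (circle r).
Proof.
apply: continuous_compact; last exact: segment_compact.
exact/continuous_subspaceT/circle_pt_continuous.
Qed.

(** Winding number one: along the circle the argument minus [t] would be constant, yet t = 0 and t =
    2 pi give the same point and so the same argument. *)
Lemma circle_not_nullhomotopic r v : 0 < r -> v != 0 ->
  ~ homotopic_dir (circle r) id (fun=> v).
Proof.
move=> r0 v0 [a ca aP].
pose b t := a (circle_pt r t) - t.
have pi0 := pi_gt0 R.
have cir t : `[0, 2 * pi]%classic t -> circle r (circle_pt r t) by exists t.
have tb t : `[0, 2 * pi]%classic t -> turn (b t) v (r, 0).
  move=> /cir/aP at_; apply: turnD at_ _; exists 1 => //.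
  rewrite /rot /circle_pt /= cosN sinN; split; last by lra.
  transitivity (r * (cos t ^+ 2 + sin t ^+ 2)); last by lra.
  by rewrite cos2Dsin2 mulr1.
have I0 : `[0, 2 * pi]%classic (0 : R) by rewrite /= in_itv /= lexx; nra.
have I1 : `[0, 2 * pi]%classic (2 * pi : R) by rewrite /= in_itv /= lexx andbT; nra.
have : b (2 * pi) - b 0 = b 0 - b 0.
  apply: (@cos1_const _ _ `[0, 2 * pi] (fun t => b t - b 0)) => //.
  - exact: segment_connected.
  - move=> t; apply: cvgB; last exact: cvg_cst.
    apply: cvgB; last exact/(continuous_subspaceT (fun x => cvg_id)).
    apply: (within_comp_continuous (continuous_subspaceT (@circle_pt_continuous r)) ca).
    by [].
  - move=> t It; apply: (turn_id v0).
    exact: turnD (tb _ It) (turnN (tb _ I0)).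
rewrite /b; have -> : circle_pt r (2 * pi) = circle_pt r 0.
  by rewrite /circle_pt mulr_natl cos2pi sin2pi cos0 sin0.
by move: (a _) => k; lra.
Qed.

(* If the angle between [z - o] and [z - d] were continuous on [X], extending it
   by Tietze inside [G] would turn [z - o] into a map without zeros. *)
Lemma not_linked X G o d (b : R) : compact X -> open G ->
    (forall z, G z -> `|z.1| < b /\ `|z.2| < b) -> closure G `<=` G `|` X ->
  G o -> ~ G d -> ~ X d -> ~ linked X o d.
Proof.
move=> cX oG bG GX Go nGd nXd [a ca aP].
have [a' [aa' ca' _]] : exists a' : R * R -> R,
    [/\ {in X, a =1 a'}, continuous a' & True].
  have /compact_bounded : compact (a @` X) by exact: continuous_compact.
  case=> k [_ kP].
  have [|||g [ag cg _]] := @continuous_bounded_extension _ R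
    (@pseudometric_normal R (R * R)%type) X _ a (`|k| + 1) _ ca _.
  - exact: compact_closed (@norm_hausdorff _ _) cX.
  - by rewrite ltr_wpDl.
  - move=> x Xx; apply: kP; last by exists x.
    by rewrite (le_lt_trans (ler_norm k)) // ltrDl.
  by exists g.
(* [z - d] has no zero on the closure of [G], and [z - o] none off [G]; on the frontier of [G],
   which lies in [X], the angle [a] makes the two formulas agree. *)
pose M z := if z \in G then rot (a' z) (unit_vec (z - d)) else unit_vec (z - o).
have zd z : closure G z -> z - d != 0.
  move=> cGz; rewrite subr_eq0; apply/eqP => zd.
  by case: (GX _ cGz); rewrite zd.
have zo z : ~ G z -> z - o != 0.
  by move=> nGz; rewrite subr_eq0; apply/eqP => zo; apply: nGz; rewrite zo.
have MG z : closure G z -> M z = rot (a' z) (unit_vec (z - d)).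
  move=> cGz; rewrite /M; case: ifPn => // /negP; rewrite inE => nGz.
  have Xz : X z by case: (GX _ cGz).
  by rewrite -aa' ?inE // -(turn_unit_vec _ (aP _ Xz)) // zd.
have cM : continuous M.
  have cMG : {within closure G, continuous M}.
    apply: (subspace_eq_continuous (f := fun z => rot (a' z) (unit_vec (z - d)))).
      by move=> z; rewrite inE => cGz; rewrite /from_subspace MG.
    apply: continuous_in_subspaceT => z; rewrite inE => cGz.
    by apply: rot_continuous; [exact: ca'|apply: unit_vec_cvg; [exact: zd|exact: continuous_subl]].
  have cMC : {within ~` G, continuous M}.
    apply: (subspace_eq_continuous (f := fun z => unit_vec (z - o))).
      move=> z; rewrite inE => nGz; rewrite /from_subspace /M ifN //.
      by apply/negP; rewrite inE.
    apply: continuous_in_subspaceT => z; rewrite inE => nGz.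
    by apply: unit_vec_cvg; [exact: zo|exact: continuous_subl].
  have : {within closure G `|` ~` G, continuous M}.
    by apply: withinU_continuous => //; [exact: closed_closure|exact: open_closedC].
  have -> : closure G `|` ~` G = setT.
    apply/seteqP; split=> // z _; have [Gz|nGz] := pselect (G z); last by right.
    by left; exact: subset_closure.
  by move=> cT z; have := cT z; rewrite /continuous_at nbhs_subspaceT.
have unit0 v : v != 0 -> unit_vec v != 0.
  by move=> v0; exact: turn_neq0 (turn_unit v0) v0.
have M0 z : M z != 0.
  have [Gz|nGz] := pselect (G z).
    have cGz : closure G z by exact: subset_closure.
    rewrite MG //; have v0 := unit0 _ (zd _ cGz).
    apply: (@turn_neq0 _ (a' z) _ _ _ v0).
    by exists 1 => //; rewrite !mul1r.
  by rewrite /M ifN ?unit0 ?zo //; apply/negP; rewrite inE.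
have [ ob1 ob2] := bG _ Go.
have b0 : 0 < b by exact: le_lt_trans ob1.
(* Points of [G], among them [o], have norm below sqrt 2 times [b] and lie inside this circle. On it
   [M] has the direction of [z - o], which winds once. *)
pose S := circle (2 * b).
have S_norm z : S z -> dot z z = (2 * b) ^+ 2.
  case=> t _ <-; rewrite /circle_pt /dot /=.
  transitivity ((2 * b) ^+ 2 * (cos t ^+ 2 + sin t ^+ 2)); first by lra.
  by rewrite cos2Dsin2 mulr1.
have SG z : S z -> ~ G z.
  move=> /S_norm + /bG []; rewrite /dot !ltr_norml.
  by move=> + /andP[? ?] /andP[? ?]; nra.
have h1 : homotopic_dir S M (fun=> M 0).
  by apply: plane_map_nullhomotopic => //; exact: circle_compact.
have h2 : homotopic_dir S M (fun z => z - o).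
  exists (fun=> 0); first by move=> ?; exact: cvg_cst.
  move=> z /SG nGz; rewrite /M ifN; last by apply/negP; rewrite inE.
  exact/turn_unit/zo.
have h3 : homotopic_dir S id (fun z => z - o).
  apply: hdir_dot; first by apply: continuous_subspaceT => z; exact: cvg_id.
    exact/continuous_subspaceT/continuous_subl.
  case=> z1 z2 [t _ [<- <-]]; rewrite /dot /=.
  have : `|o.1 * cos t| < b.
    rewrite normrM; apply: le_lt_trans ob1.
    by rewrite ler_piMr // cos_max.
  have : `|o.2 * sin t| < b.
    rewrite normrM; apply: le_lt_trans ob2.
    by rewrite ler_piMr // sin_max.
  rewrite !ltr_norml => /andP[_ k2] /andP[_ k1].
  have cs := cos2Dsin2 t.
  have -> : (2 * b * cos t - o.1) * (2 * b * cos t) + (2 * b * sin t - o.2) * (2 * b * sin t) =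
    (2 * b) * (2 * b * (cos t ^+ 2 + sin t ^+ 2) - o.1 * cos t - o.2 * sin t) by lra.
  by rewrite cs mulr1 mulr_gt0 ?mulr_gt0 //; lra.
apply: (@circle_not_nullhomotopic (2 * b) (M 0)); [by rewrite mulr_gt0|exact: M0|].
exact: hdir_trans h3 (hdir_trans (hdir_sym h2) h1).
Qed.

End PlaneSeparation.

(** * Squares, and continua inside connected open sets *)

Section PlaneSets.
Context {R : realType}.
Implicit Types (X A : set (R * R)) (c p q z : R * R) (e : R).

Lemma star_connected A c : A c ->
  (forall z t, A z -> 0 <= t <= 1 ->
     A (c.1 + t * (z.1 - c.1), c.2 + t * (z.2 - c.2))) ->
  connected A.
Proof.
move=> Ac Astar.
pose s z t : R * R := (c.1 + t * (z.1 - c.1), c.2 + t * (z.2 - c.2)).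
have -> : A = \bigcup_(z in A) (s z @` `[0, 1]).
  apply/seteqP; split=> [z Az|z [w Aw [t /=]]].
    exists z => //; exists 1; first by rewrite /= in_itv /= ler01 lexx.
    by rewrite /s !mul1r !subrKC -surjective_pairing.
  by rewrite in_itv /= => t01 <-; exact: Astar.
apply: bigcup_connected.
  exists c => z Az; exists 0; first by rewrite /= in_itv /= ler01 lexx.
  by rewrite /s !mul0r !addr0 -surjective_pairing.
move=> z Az; apply: connected_continuous_connected; first exact: segment_connected.
apply: continuous_subspaceT => t; apply/cvg_coords; split;
  by apply: cvgD; [exact: cvg_cst|apply: cvgM; [exact: cvg_id|exact: cvg_cst]].
Qed.

Definition cbox c e := [set z | `|z.1 - c.1| <= e /\ `|z.2 - c.2| <= e].

Lemma cbox_compact c e : compact (cbox c e).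
Proof.
have -> : cbox c e = `[c.1 - e, c.1 + e] `*` `[c.2 - e, c.2 + e].
  by apply/seteqP; split=> z; rewrite /cbox /= !in_itv /= !ler_distl => -[].
by apply: compact_setX; exact: segment_compact.
Qed.

Lemma cbox_connected c e : 0 <= e -> connected (cbox c e).
Proof.
move=> e0; apply: (@star_connected _ c).
  by rewrite /cbox /= !subrr normr0.
move=> z t [z1 z2] /andP[t0 t1]; rewrite /cbox /= !(addrC c.1) !(addrC c.2) !addrK.
by rewrite !normrM !(ger0_norm t0); split; [apply: le_trans z1|apply: le_trans z2];
  rewrite ler_piMl.
Qed.

Lemma segment_gt (a x y t : R) : a < x -> a < y -> 0 <= t <= 1 ->
  a < x + t * (y - x).
Proof.
move=> ax ay /andP[t0 t1]; have [tx|tx] := leP t (1 / 2).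
  have : 0 <= t * (y - a) by rewrite mulr_ge0 // subr_ge0 ltW.
  by nra.
have : 0 <= (1 - t) * (x - a) by rewrite mulr_ge0 // subr_ge0 // ltW.
by nra.
Qed.

Lemma segment_lt (a x y t : R) : x < a -> y < a -> 0 <= t <= 1 ->
  x + t * (y - x) < a.
Proof.
move=> xa ya t01; rewrite -ltrN2.
have -> : - (x + t * (y - x)) = - x + t * (- y - - x) by lra.
by apply: segment_gt; rewrite ?ltrN2.
Qed.

(** Four open half planes cover the complement, and consecutive ones overlap in a corner
    quadrant. *)
Lemma cboxC_connected c e : connected (~` cbox c e).
Proof.
pose H1 := [set z : R * R | c.1 + e < z.1].
pose H2 := [set z : R * R | c.2 + e < z.2].
pose H3 := [set z : R * R | z.1 < c.1 - e].
pose H4 := [set z : R * R | z.2 < c.2 - e].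
have [e0|e0] := ltP e 0.
  have -> : ~` cbox c e = setT.
    apply/seteqP; split=> // z _ [z1 _].
    by have := le_lt_trans z1 e0; rewrite normr_lt0.
  by apply: (@star_connected _ c).
have -> : ~` cbox c e = ((H1 `|` H2) `|` H3) `|` H4.
  apply/seteqP; split=> z; rewrite /cbox /H1 /H2 /H3 /H4 /= !ler_distl.
    move=> h; apply: contrapT => /not_orP[/not_orP[/not_orP[]]].
    move=> /negP + /negP + /negP + /negP; rewrite -!leNgt => ? ? ? ?.
    by apply: h; split; apply/andP.
  by move=> + [/andP[? ?] /andP[? ?]] => -[[[?|?]|?]|?]; lra.
have cH1 : connected H1.
  apply: (@star_connected _ (c.1 + e + 1, 0)); first by rewrite /H1 /= ltrDl.
  by move=> z t; rewrite /H1 /= => z1; apply: segment_gt => //; lra.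
have cH2 : connected H2.
  apply: (@star_connected _ (0, c.2 + e + 1)); first by rewrite /H2 /= ltrDl.
  by move=> z t; rewrite /H2 /= => z1; apply: segment_gt => //; lra.
have cH3 : connected H3.
  apply: (@star_connected _ (c.1 - e - 1, 0)); first by rewrite /H3 /= ltrBlDr ltrDl.
  by move=> z t; rewrite /H3 /= => z1; apply: segment_lt => //; lra.
have cH4 : connected H4.
  apply: (@star_connected _ (0, c.2 - e - 1)); first by rewrite /H4 /= ltrBlDr ltrDl.
  by move=> z t; rewrite /H4 /= => z1; apply: segment_lt => //; lra.
apply: connectedU => //.
  by exists (c.1 - e - 1, c.2 - e - 1); split; [right|]; rewrite /H3 /H4 /=; lra.
apply: connectedU => //.
  by exists (c.1 - e - 1, c.2 + e + 1); split; [right|]; rewrite /H3 /H2 /=; lra.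
apply: connectedU => //.
by exists (c.1 + e + 1, c.2 + e + 1); split; rewrite /H1 /H2 /=; lra.
Qed.

Lemma nbhs_cbox p (U : set (R * R)) : nbhs p U <->
  exists2 e, 0 < e & cbox p e `<=` U.
Proof.
split=> [/nbhs_box[e e0 eU]|[e e0 eU]].
  exists (e / 2); first by rewrite divr_gt0.
  by move=> q [q1 q2]; apply: eU; [apply: (le_lt_trans q1)|apply: (le_lt_trans q2)]; lra.
by apply/nbhs_box; exists e => // q q1 q2; apply: eU; split; exact: ltW.
Qed.

(** The points joined to [p] by a continuum in [W] form a relatively clopen set, hence all of [W].
    Finitely many such continua, enlarged by squares, cover [C], and they share [p]. *)
Lemma continuum_exhaustion (W C : set (R * R)) : open W -> connected W ->
  W !=set0 -> compact C -> C `<=` W ->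
  exists T, [/\ compact T, connected T, T !=set0, C `<=` T & T `<=` W].
Proof.
move=> oW cW [p Wp] cC CW.
pose good q := exists T, [/\ compact T, connected T, T `<=` W, T p & T q].
have ext q r e : 0 < e -> cbox q e `<=` W -> cbox q e r -> good q -> good r.
  move=> e0 qW qr [T [kT cT TW Tp Tq]]; exists (T `|` cbox q e); split.
  - by apply: compactU => //; exact: cbox_compact.
  - apply: connectedU => //; last by apply: cbox_connected; exact: ltW.
    by exists q; split => //; rewrite /cbox /= !subrr normr0 ltW.
  - by move=> x []; [exact: TW|exact: qW].
  - by left.
  - by right.
have cboxC (q r : R * R) e : cbox q e r -> cbox r e q.
  by case=> h1 h2; split; rewrite distrC.
have Wbox q : W q -> exists2 e, 0 < e & forall r, cbox q e r -> cbox r e `<=` W.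
  move=> Wq; have /nbhs_cbox[e e0 eW] : nbhs q W by exact: open_nbhs_nbhs.
  exists (e / 2); first by rewrite divr_gt0.
  move=> r [r1 r2] x [x1 x2]; apply: eW; split.
    rewrite -(subrKA r.1) (le_trans (ler_normD _ _)) //.
    by move: r1 x1; lra.
  rewrite -(subrKA r.2) (le_trans (ler_normD _ _)) //.
  by move: r2 x2; lra.
have allgood q : W q -> good q.
  have gp : good p.
    by exists [set p]; split => //; [exact: compact_set1|exact: connected1|move=> _ ->].
  have loc q' : W q' -> exists2 e, 0 < e & forall r, cbox q' e r -> good q' <-> good r.
    move=> /Wbox [e e0 eW]; exists e => // r qr.
    have q'W : cbox q' e `<=` W by apply: eW; split; rewrite subrr normr0 ltW.
    split; first exact: ext e0 q'W qr.
    exact: ext e0 (eW _ qr) (cboxC _ _ _ qr).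
  pose S := [set r | W r /\ good r].
  suff SW : S = W.
    by move=> Wq; have : S q; [rewrite SW|case].
  apply: cW; first by exists p.
    exists S; last by apply/seteqP; split=> r [] => [? ?|? []].
    rewrite openE => r [Wr gr]; have [e e0 eP] := loc _ Wr.
    have : nbhs r W by exact: open_nbhs_nbhs.
    move/nbhs_cbox => [e' e'0 e'W]; apply/nbhs_box.
    exists (Num.min e e'); first by rewrite lt_min e0.
    move=> x; rewrite !lt_min => /andP[/ltW x1 /ltW x1'] /andP[/ltW x2 /ltW x2'].
    by split; [exact: e'W|apply/(eP x)].
  exists (~` [set r | W r /\ ~ good r]).
    apply: open_closedC; rewrite openE => r [Wr gr]; have [e e0 eP] := loc _ Wr.
    have : nbhs r W by exact: open_nbhs_nbhs.
    move/nbhs_cbox => [e' e'0 e'W]; apply/nbhs_box.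
    exists (Num.min e e'); first by rewrite lt_min e0.
    move=> x; rewrite !lt_min => /andP[/ltW x1 /ltW x1'] /andP[/ltW x2 /ltW x2'].
    by split; [exact: e'W|move=> gx; apply: gr; apply/(eP x)].
  apply/seteqP; split=> r [Wr gr]; split => //; first by case.
  by apply: contrapT => ngr; apply: gr.
pose cov D := exists T, [/\ compact T, connected T, T p, D `<=` T & T `<=` W].
have cov0 : cov set0.
  by exists [set p]; split => //; [exact: compact_set1|exact: connected1|move=> _ ->].
have covU D E : cov D -> cov E -> cov (D `|` E).
  move=> [S [kS cS Sp DS SW]] [T [kT cT Tp ET TW]]; exists (S `|` T); split.
  - exact: compactU.
  - by apply: connectedU => //; exists p.
  - by left.
  - by move=> x [/DS|/ET]; [left|right].
  - by move=> x [/SW|/TW].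
have covS D E : D `<=` E -> cov E -> cov D.
  by move=> DE [T [kT cT Tp ET TW]]; exists T; split => // x /DE/ET.
suff : cov C by case=> T [kT cT Tp CT TW]; exists T; split => //; exists p.
(* Finite covering in filter form: if [C] were not coverable, the sets with coverable complement in
   [C] would form a proper filter, but a square about a cluster point is coverable. *)
apply: contrapT => ncov; pose F := [set A | cov (C `\` A)].
have FF : ProperFilter F.
  split; first by rewrite /F /= setD0.
  split; first by rewrite /F /= setDT.
  - by move=> A B FA FB; rewrite /F /= setDIr; exact: covU.
  - by move=> A B AB; apply: covS => x [Cx nBx]; split => // /AB.
have FC : F C by rewrite /F /= setDv.
have [q [Cq clq]] := cC F FF FC.
have Wq := CW _ Cq; have [e e0 eW] := Wbox _ Wq.
have qe : cbox q e q by split; rewrite subrr normr0 ltW.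
have : F (~` cbox q e).
  have [T [kT cT TW Tp Tq]] := allgood _ Wq.
  exists (T `|` cbox q e); split.
  - by apply: compactU => //; exact: cbox_compact.
  - by apply: connectedU => //; [exists q|apply: cbox_connected; exact: ltW].
  - by left.
  - by move=> x [_ /contrapT]; right.
  - by move=> x []; [exact: TW|exact: eW _ qe _].
have bq : nbhs q (cbox q e) by apply/nbhs_cbox; exists e.
by move=> /clq /(_ bq) [x []].
Qed.

End PlaneSets.

(** * Jordan curves *)

Section Arcs.
Context {R : realType}.
Implicit Types (X A : set (R * R)) (p q z o d : R * R).

Lemma plane_compact_closed X : compact X -> closed X.
Proof. exact: compact_closed (@norm_hausdorff _ _). Qed.

Lemma compact_sub_cbox X : compact X -> exists2 b, 0 < b & X `<=` cbox 0 b.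
Proof.
move=> /compact_bounded [k [_ kP]]; exists (`|k| + 1); first by rewrite ltr_wpDl.
move=> z /(kP (`|k| + 1)) h; have : `|z| <= `|k| + 1.
  by apply: h; rewrite (le_lt_trans (ler_norm k)) // ltrDl.
by rewrite prod_normE ge_max /cbox /= !subr0 => /andP[].
Qed.

Lemma segment_image_compact (g : R -> R * R) (u v : R) :
  {within `[u, v], continuous g} -> compact (g @` `[u, v]).
Proof. by move=> cg; apply: continuous_compact => //; exact: segment_compact. Qed.

Lemma segment_image_connected (g : R -> R * R) (u v : R) :
  {within `[u, v], continuous g} -> connected (g @` `[u, v]).
Proof.
by move=> cg; apply: connected_continuous_connected => //; exact: segment_connected.
Qed.

Lemma subsegment (u v s t : R) : u <= s -> t <= v ->
  (`[s, t] `<=` `[u, v])%classic.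
Proof. by move=> us tv x /=; rewrite !in_itv /= => /andP[? ?]; apply/andP; lra. Qed.

(** A short subarc lies in a square that avoids [o] and [d] and has connected complement. Adjacent
    subarcs meet in one point by injectivity, so their angles glue. *)
Lemma linked_arc (g : R -> R * R) (u v : R) o d : u <= v ->
  {within `[u, v], continuous g} -> {in `[u, v] &, injective g} ->
  ~ (g @` `[u, v]) o -> ~ (g @` `[u, v]) d -> linked (g @` `[u, v]) o d.
Proof.
move=> uv cg ig no nd; set J := g @` `[u, v] in no nd.
have cgs s t : u <= s -> t <= v -> {within `[s, t], continuous g}.
  by move=> us tv; apply: continuous_subspaceW cg; exact: subsegment.
have clg s t : u <= s -> t <= v -> closed (g @` `[s, t]).
  by move=> us tv; apply: plane_compact_closed; apply: segment_image_compact; exact: cgs.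
pose P s t := linked (g @` `[s, t]) o d.
suff : P u v by [].
apply: cousin uv _ _; rewrite /P.
  move=> s t r us st tr rv lst ltr.
  have cap : (g @` `[s, t]) `&` (g @` `[t, r]) = [set g t].
    apply/seteqP; split=> [z [[x xst <-] [y ytr yx]]|_ ->].
      move: xst ytr; rewrite /= !in_itv /= => /andP[? ?] /andP[? ?].
      have : y = x by apply: ig => //; rewrite in_itv /=; apply/andP; lra.
      by move=> yx'; congr g; lra.
    by split; exists t => //; rewrite /= in_itv /=; apply/andP; lra.
  have -> : g @` `[s, r] = (g @` `[s, t]) `|` (g @` `[t, r]).
    rewrite -image_setU; congr image; apply/seteqP; split=> x /=; rewrite !in_itv /=.
      by move=> /andP[? ?]; case: (lerP x t) => ?; [left|right]; apply/andP; lra.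
    by case=> /andP[? ?]; apply/andP; lra.
  apply: linked_glue => //; rewrite ?cap.
  - by apply: clg => //; lra.
  - by apply: clg => //; lra.
  - exact: connected1.
  - by exists (g t).
  - move=> dt; apply: nd; exists t; last by rewrite dt.
    by rewrite /= in_itv /=; apply/andP; lra.
move=> t tuv; have Jt : J (g t) by exists t.
have [e e0 ebox] : exists2 e, 0 < e & cbox (g t) e `<=` ~` ([set o] `|` [set d]).
  apply/nbhs_cbox; apply: open_nbhs_nbhs; split.
    by apply: closed_openC; apply: plane_compact_closed; apply: compactU; exact: compact_set1.
  by case=> /= gt; rewrite gt in Jt.
have lbox : linked (cbox (g t) e) o d.
  apply: (@linked_connected _ _ (~` cbox (g t) e)).
  - by apply: plane_compact_closed; exact: cbox_compact.
  - exact: cboxC_connected.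
  - exact: setICl.
  - by move=> /ebox; apply; left.
  - by move=> /ebox; apply; right.
have : nbhs (g t) (cbox (g t) e) by apply/nbhs_cbox; exists e.
move: cg => /subspace_continuousP /(_ t tuv) /[apply].
rewrite nbhs_simpl /= /within /= => /nbhs_ballP[k /= k0 kP].
exists k => // s r us sr rv ts rt; apply: hdir_sub lbox => z [x xsr <-].
move: xsr; rewrite /= in_itv /= => /andP[? ?]; apply: kP.
  by rewrite /ball /= ltr_norml; apply/andP; lra.
by rewrite /= in_itv /=; apply/andP; lra.
Qed.

End Arcs.

(** * Jordan curves separate the plane *)

Section JordanCurve.
Context {R : realType}.
Variable g : R -> R * R.
Hypothesis cg : {within `[0, 1], continuous g}.
Hypothesis g01 : g 0 = g 1.
Hypothesis ig : {in `[0, 1[ &, injective g}.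
Let J := g @` `[0, 1].

Lemma curve_within s t : 0 <= s -> t <= 1 -> {within `[s, t], continuous g}.
Proof. by move=> ? ?; apply: continuous_subspaceW cg; exact: subsegment. Qed.

Lemma curve_compact s t : 0 <= s -> t <= 1 -> compact (g @` `[s, t]).
Proof. by move=> ? ?; apply: segment_image_compact; exact: curve_within. Qed.

Lemma curve_closed s t : 0 <= s -> t <= 1 -> closed (g @` `[s, t]).
Proof. by move=> ? ?; apply: plane_compact_closed; exact: curve_compact. Qed.

Lemma curve_connected s t : 0 <= s -> t <= 1 -> connected (g @` `[s, t]).
Proof. by move=> ? ?; apply: segment_image_connected; exact: curve_within. Qed.

Lemma curve_inj s t : 0 <= s -> s <= t -> t <= 1 -> g s = g t ->
  s = t \/ s = 0 /\ t = 1.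
Proof.
move=> s0 st t1 gst; have [t1'|t1'] := ltP t 1.
  by left; apply: ig => //; rewrite in_itv /=; apply/andP; lra.
have tE : t = 1 by lra.
have [s1|s1] := ltP s 1; last by left; lra.
right; split => //; apply: ig; rewrite ?in_itv /= ?lexx ?ltr01 ?s0 //.
by rewrite g01 gst tE.
Qed.

Lemma curve_inj_in s t : 0 <= s -> t <= 1 -> (0 < s) || (t < 1) ->
  {in `[s, t] &, injective g}.
Proof.
move=> s0 t1 st x y; rewrite !in_itv /= => /andP[sx xt] /andP[sy yt] gxy.
have [x0 y0] : 0 <= x /\ 0 <= y by lra.
have [x1 y1] : x <= 1 /\ y <= 1 by lra.
have [xy|/ltW yx] := leP x y.
  case: (curve_inj x0 xy y1 gxy) => // -[xE yE].
  by case/orP: st; lra.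
case: (curve_inj y0 yx x1 (esym gxy)) => // -[yE xE].
by case/orP: st; lra.
Qed.

Lemma curve_split t : 0 <= t <= 1 -> J = g @` `[0, t] `|` g @` `[t, 1].
Proof.
move=> /andP[t0 t1]; rewrite -image_setU; congr image; apply/seteqP.
split=> x /=; rewrite !in_itv /=.
  by move=> /andP[? ?]; case: (lerP x t) => ?; [left|right]; apply/andP; lra.
by case=> /andP[? ?]; apply/andP; lra.
Qed.

Lemma curve_linked s t o d : 0 <= s -> s <= t -> t <= 1 -> (0 < s) || (t < 1) ->
  ~ J o -> ~ J d -> linked (g @` `[s, t]) o d.
Proof.
move=> s0 st t1 st01 nJo nJd.
have sub : g @` `[s, t] `<=` J by apply: image_subset; exact: subsegment.
apply: linked_arc => //; [exact: curve_within|exact: curve_inj_in|by move/sub|by move/sub].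
Qed.

(* Two arcs of [J] with endpoints [a], [b]: a small square around [a] splits into
   a part off the first arc and a part off the second.  Were the complement of
   [J] connected, the two parts could be enlarged to compacta with connected
   intersection, and [a], [b] would be linked by the square. *)
Lemma jordan_separation : ~ connected (~` J).
Proof.
move=> cJ; pose a := g 0; pose b := g (1 / 2).
pose A := g @` `[0, 1 / 2]; pose B := g @` `[1 / 2, 1].
have half : 0 <= (1 / 2 : R) <= 1 by apply/andP; lra.
have JAB : J = A `|` B by exact: curve_split.
have kA : compact A by apply: curve_compact; lra.
have kB : compact B by apply: curve_compact; lra.
have kJ : compact J by apply: curve_compact.
have Aa : A a by exists 0 => //; rewrite /= in_itv /= lexx; lra.
have Ab : A b by exists (1 / 2) => //; rewrite /= in_itv /= lexx andbT; lra.
have Ba : B a by exists 1; rewrite /a ?g01 //= in_itv /= lexx andbT; lra.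
have Bb : B b by exists (1 / 2) => //; rewrite /= in_itv /= lexx /=; lra.
have ABE z : A z -> B z -> z = a \/ z = b.
  move=> [x + <-] [y +]; rewrite /= !in_itv /= => /andP[x0 x2] /andP[y2 y1] gyx.
  have xy : x <= y by lra.
  case: (curve_inj x0 xy y1 (esym gyx)) => [xE|[-> _]]; last by left.
  by right; rewrite /b; congr g; lra.
have ab : a != b.
  apply/eqP => gab; have h0 : (0 : R) <= 1 / 2 by lra.
  by case: (curve_inj (lexx 0) h0 _ gab); lra.
(* Distance from [a] to [b] in the maximum norm: the square of half side m / 2 about [a] leaves [b]
   outside. *)
pose m := Num.max `|b.1 - a.1| `|b.2 - a.2|.
have m0 : 0 < m.
  rewrite lt_max !normr_gt0 !subr_eq0 -negb_and; apply: contra ab => /andP[/eqP h1 /eqP h2].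
  by apply/eqP; rewrite [LHS]surjective_pairing -h1 -h2 -surjective_pairing.
pose G := [set z : R * R | `|z.1 - a.1| < m / 2 /\ `|z.2 - a.2| < m / 2].
pose S := cbox a (m / 2) `\` G.
have oG : open G.
  rewrite openE => z [z1 z2]; apply/nbhs_box.
  exists (Num.min (m / 2 - `|z.1 - a.1|) (m / 2 - `|z.2 - a.2|)).
    by rewrite lt_min !subr_gt0 z1.
  move=> q; rewrite !lt_min => /andP[q1 _] /andP[_ q2]; split.
    by rewrite -(subrKA z.1) (le_lt_trans (ler_normD _ _)) // -ltrBrDr.
  by rewrite -(subrKA z.2) (le_lt_trans (ler_normD _ _)) // -ltrBrDr.
have kS : compact S.
  apply: (subclosed_compact _ (@cbox_compact _ a (m / 2))); last by move=> z [].
  apply: closedI; last exact: open_closedC.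
  by apply: plane_compact_closed; exact: cbox_compact.
have clS : closed S by exact: plane_compact_closed.
have Ga : G a by rewrite /G /= !subrr normr0 divr_gt0.
have nboxb : ~ cbox a (m / 2) b.
  move=> [b1 b2]; have : m <= m / 2 by rewrite /m ge_max b1.
  by lra.
have nSa : ~ S a by move=> [].
have nSb : ~ S b by move=> [].
have clA := plane_compact_closed kA; have clB := plane_compact_closed kB.
have SAB : (S `&` A) `&` (S `&` B) = set0.
  apply/seteqP; split=> // z [[Sz Az] [_ Bz]].
  by case: (ABE _ Az Bz) Sz => ->.
(* The arcs share only [a] and [b], both off the frontier [S] of the square, so they meet [S] in
   disjoint closed sets. The level 1/2 of a Urysohn function cuts [S] into [S1] off [A] and [S2] off
   [B]. *)
have [u [cu uA uB _]] := @urysohn_ext_itv _ R (@pseudometric_normal R (R * R)%type)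
  _ _ 0 1 (closedI clS clA) (closedI clS clB) SAB ltr01.
pose S1 := S `&` [set z | 1 / 2 <= u z].
pose S2 := S `&` [set z | u z <= 1 / 2].
have clS1 : closed S1.
  apply: closedI => //; have := @preimage_closed _ _ u [set x | 1 / 2 <= x].
  by apply => //; exact: closed_ge.
have clS2 : closed S2.
  apply: closedI => //; have := @preimage_closed _ _ u [set x | x <= 1 / 2].
  by apply => //; exact: closed_le.
have S1A : S1 `&` A = set0.
  apply/seteqP; split=> // z [[Sz /= uz] Az].
  have /uA : (u @` (S `&` A)) (u z) by exists z.
  by move=> /= uz0; lra.
have S2B : S2 `&` B = set0.
  apply/seteqP; split=> // z [[Sz /= uz] Bz].
  have /uB : (u @` (S `&` B)) (u z) by exists z.
  by move=> /= uz0; lra.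
have SE : S = S1 `|` S2.
  apply/seteqP; split=> z; last by case=> -[].
  by move=> Sz; case: (leP (1 / 2) (u z)) => [?|/ltW ?]; [left|right].
have kS12 : compact (S1 `&` S2).
  by apply: (subclosed_compact _ kS); [exact: closedI|move=> z [[]]].
have J0 : ~` J !=set0.
  have [m' m'0 Jm] := compact_sub_cbox kJ.
  exists (m' + 1, 0) => /Jm [/=]; rewrite subr0 ger0_norm; lra.
have S12J : S1 `&` S2 `<=` ~` J.
  move=> z [S1z S2z]; rewrite JAB => -[Az|Bz].
    by have : set0 z by rewrite -S1A.
  by have : set0 z by rewrite -S2B.
have [T [kT cT T0 S12T TJ]] := continuum_exhaustion
  (closed_openC (plane_compact_closed kJ)) cJ J0 kS12 S12J.
have clT := plane_compact_closed kT.
have JA z : A z -> J z by rewrite JAB; left.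
have JB z : B z -> J z by rewrite JAB; right.
have l1 : linked (S1 `|` T) a b.
  apply: (linked_connected (C := A)) => //; [exact: closedU|by apply: curve_connected; lra|].
  apply/seteqP; split=> // z [Az [S1z|Tz]]; last by case: (TJ _ Tz); exact: JA.
  by rewrite -S1A; split.
have l2 : linked (S2 `|` T) a b.
  apply: (linked_connected (C := B)) => //; [exact: closedU|by apply: curve_connected; lra|].
  apply/seteqP; split=> // z [Bz [S2z|Tz]]; last by case: (TJ _ Tz); exact: JB.
  by rewrite -S2B; split.
have cap : (S1 `|` T) `&` (S2 `|` T) = T.
  by rewrite -setUIl setUidr.
have l : linked ((S1 `|` T) `|` (S2 `|` T)) a b.
  apply: linked_glue; rewrite ?cap //; [exact: closedU|exact: closedU|].
  by move=> /TJ; apply; exact: JB.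
have lS : linked S a b.
  by apply: hdir_sub l; rewrite SE => z [S1z|S2z]; [left; left|right; left].
(* The open square [G] contains [a] but not [b], and its frontier is in [S]; hence [S] cannot link
   them. *)
apply: (@not_linked _ S G a b (m / 2 + (`|a.1| + `|a.2|))) => //.
- move=> z [z1 z2]; split.
    rewrite -[z.1](subrK a.1) (le_lt_trans (ler_normD _ _)) //.
    by have := normr_ge0 a.2; lra.
  rewrite -[z.2](subrK a.2) (le_lt_trans (ler_normD _ _)) //.
  by have := normr_ge0 a.1; lra.
- have GB : G `<=` cbox a (m / 2) by move=> z [/ltW ? /ltW ?].
  move=> z clz; have [Gz|nGz] := pselect (G z); [by left|right; split => //].
  have : closed (cbox a (m / 2)) by apply: plane_compact_closed; exact: cbox_compact.
  by move/closure_id => ->; exact: closureS clz.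
- by move=> [/ltW ? /ltW ?]; apply: nboxb.
Qed.

(** A component of the complement that misses the far point (b + 1, 0) stays in the big square,
    whose outside is connected. Squares being connected, it is open and its closure gains points of
    [J] only. *)
Lemma jordan_interior : exists G b, [/\ open G /\ connected G, G !=set0,
  forall z, G z -> `|z.1| < b /\ `|z.2| < b, G `&` J = set0 &
  closure G `<=` G `|` J].
Proof.
have kJ : compact J by exact: curve_compact.
have clJ := plane_compact_closed kJ.
have [b b0 Jb] := compact_sub_cbox kJ.
have EJ : ~` cbox 0 b `<=` ~` J by apply: subsetC.
have e0E : (~` cbox 0 b) (b + 1, 0).
  by move=> [/=]; rewrite subr0 ger0_norm; lra.
have [p nJp npe] : exists2 p, ~ J p & ~ connected_component (~` J) (b + 1, 0) p.
  apply: contrapT => h; apply: jordan_separation.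
  rewrite (_ : ~` J = connected_component (~` J) (b + 1, 0)).
    exact: component_connected.
  apply/seteqP; split=> [p nJp|]; last exact: connected_component_sub.
  by apply: contrapT => npe; apply: h; exists p.
pose G := connected_component (~` J) p.
have box z e : 0 < e -> cbox z e `<=` ~` J -> forall w, cbox z e w ->
    G w -> cbox z e `<=` G.
  move=> e0 zJ w zw Gw; have -> : G = connected_component (~` J) w.
    exact: same_connected_component.
  by apply: connected_component_max => //; apply: cbox_connected; exact: ltW.
have nbJ z : ~ J z -> exists2 e, 0 < e & cbox z e `<=` ~` J.
  by move=> nJz; apply/nbhs_cbox; apply: open_nbhs_nbhs; split => //; exact: closed_openC.
have zz (z : R * R) e : 0 < e -> cbox z e z.
  by move=> e0; split; rewrite subrr normr0 ltW.
have GJ : G `<=` ~` J by exact: connected_component_sub.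
exists G, (b + 1); split.
- split; last exact: component_connected.
  rewrite openE => z Gz; have [e e0 eJ] := nbJ _ (GJ _ Gz).
  by apply/nbhs_cbox; exists e => //; apply: (box z e e0 eJ z _ Gz); exact: zz.
- by exists p; exact: connected_component_refl.
- have Gb z : G z -> cbox 0 b z.
    move=> Gz; apply: contrapT => nbz; apply: npe.
    apply: (connected_component_trans (y := z)).
      exists (~` cbox 0 b) => //; split => //; exact: cboxC_connected.
    exact: connected_component_sym.
  by move=> z /Gb; rewrite /cbox /= !subr0 => -[z1 z2]; split; lra.
- by apply/seteqP; split=> // z [/GJ].
- move=> z clz; have [Jz|nJz] := pselect (J z); first by right.
  left; have [e e0 eJ] := nbJ _ nJz.
  have bz : nbhs z (cbox z e) by apply/nbhs_cbox; exists e.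
  have [w [Gw zw]] := clz _ bz.
  by apply: (box _ _ e0 eJ _ zw Gw); exact: zz.
Qed.



(** * A bounded complementary domain and its frontier *)

Section Interior.
Variables (G : set (R * R)) (b : R).
Hypothesis oG : open G.
Hypothesis cG : connected G.
Hypothesis G0 : G !=set0.
Hypothesis Gb : forall z, G z -> `|z.1| < b /\ `|z.2| < b.
Hypothesis GJ : G `&` J = set0.
Hypothesis clG : closure G `<=` G `|` J.

Lemma interior_off_curve z : G z -> ~ J z.
Proof. by move=> Gz Jz; have : set0 z by rewrite -GJ. Qed.

(** If the closure of [G] missed a short arc about [g s], the rest of [J] would still contain the
    frontier of [G]. But the rest is two arcs meeting only in [g 0], and angles on them glue, so it
    does not separate [o] from a far point. *)
Lemma open_param_closure s : 0 < s < 1 -> closure G (g s).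
Proof.
move=> /andP[s0 s1]; apply: contrapT => nGs.
have : nbhs (g s) (~` closure G).
  apply: open_nbhs_nbhs; split => //.
  by apply: closed_openC; exact: closed_closure.
have s01 : `[0, 1]%classic s by rewrite /= in_itv /= !ltW.
move: cg => /subspace_continuousP /(_ s s01) /[apply].
rewrite nbhs_simpl /= /within /= => /nbhs_ballP[k /= k0 kP].
pose h := Num.min (k / 2) (Num.min (s / 2) ((1 - s) / 2)).
have h0 : 0 < h by rewrite !lt_min; apply/and3P; split; lra.
have hk : h < k by rewrite /h !gt_min; apply/orP; left; lra.
have hs : h < s by rewrite /h !gt_min; apply/or3P; apply: Or32; lra.
have hs1 : h < 1 - s by rewrite /h !gt_min; apply/or3P; apply: Or33; lra.
pose X1 := g @` `[0, s - h]; pose X2 := g @` `[s + h, 1].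
have X1J : X1 `<=` J by apply: image_subset; apply: subsegment; lra.
have X2J : X2 `<=` J by apply: image_subset; apply: subsegment; lra.
have cap : X1 `&` X2 = [set g 0].
  apply/seteqP; split=> [z [[x + <-] [y +]]|_ ->].
    rewrite /= !in_itv /= => /andP[x0 xs] /andP[sy y1] gyx.
    have xy : x <= y by lra.
    by case: (curve_inj x0 xy y1 (esym gyx)) => [xE|[-> _]]; [exfalso; lra|].
  split; first by exists 0 => //; rewrite /= in_itv /= lexx; lra.
  by exists 1; rewrite ?g01 //= in_itv /= lexx andbT; lra.
have [ o Go] := G0.
have kJ : compact J by exact: curve_compact.
have [b' b'0 Jb] := compact_sub_cbox kJ.
have b0 : 0 < b by have [+ _] := Gb Go; apply: le_lt_trans.
pose d : R * R := (b + b' + 1, 0).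
have nJd : ~ J d by move=> /Jb [/=]; rewrite subr0 ger0_norm; lra.
have nGd : ~ G d by move=> /Gb [/=]; rewrite ger0_norm; lra.
have nJo := interior_off_curve Go.
apply: (@not_linked _ (X1 `|` X2) G o d b) => //.
- by apply: compactU; apply: curve_compact; lra.
- move=> z clz; have [Gz|[x + gx]] := clG clz; first by left.
  rewrite /= in_itv /= => /andP[x0 x1]; right.
  have [xs|xs] := leP x (s - h).
    by left; exists x => //; rewrite /= in_itv /= x0.
  have [sx|sx] := leP (s + h) x.
    by right; exists x => //; rewrite /= in_itv /= sx.
  suff : ~ closure G (g x) by rewrite gx.
  apply: kP; last by rewrite in_itv /= x0.
  by rewrite /ball /= ltr_norml; apply/andP; lra.
- by case=> [/X1J|/X2J].
apply: linked_glue.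
- by apply: curve_closed; lra.
- by apply: curve_closed; lra.
- by rewrite cap; exact: connected1.
- by rewrite cap; exists (g 0).
- by case=> /X1J.
- by apply: curve_linked => //; lra.
- by apply: curve_linked => //; lra.
Qed.

(** The parameter 0, where the curve closes up, is reached as a limit of interior parameters. *)
Lemma jordan_sub_closure : J `<=` closure G.
Proof.
suff g0 : closure G (g 0).
  move=> z [s /=]; rewrite in_itv /= => /andP[s0 s1] <-.
  have [|s0'] := ltP 0 s; last by have -> : s = 0 by lra.
  have [s1' s0'|s1' _] := ltP s 1; first by apply: open_param_closure; rewrite s0'.
  by have -> : s = 1 by [lra]; rewrite -g01.
apply: contrapT => nG0.
have : nbhs (g 0) (~` closure G).
  apply: open_nbhs_nbhs; split => //.
  by apply: closed_openC; exact: closed_closure.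
have s01 : `[0, 1]%classic (0 : R) by rewrite /= in_itv /= lexx ler01.
move: cg => /subspace_continuousP /(_ 0 s01) /[apply].
rewrite nbhs_simpl /= /within /= => /nbhs_ballP[k /= k0 kP].
pose h := Num.min (k / 2) (1 / 2).
have h0 : 0 < h by rewrite lt_min; apply/andP; split; lra.
have hk : h < k by rewrite /h gt_min; apply/orP; left; lra.
have h1 : h < 1 by rewrite /h gt_min; apply/orP; right; lra.
suff : ~ closure G (g h) by apply; apply: open_param_closure; rewrite h0.
apply: kP; last by rewrite in_itv /= !ltW.
by rewrite /ball /= sub0r normrN gtr0_norm.
Qed.

(* The classes of [G] in the complements of [Q `|` A] and of [Q `|` B], where [A]
   and [B] are the two arcs of [J] cut off by [Q], have no common point on [Q'],
   and each of them is relatively closed in [Q']. *)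
Lemma no_interleaving (Q Q' : set (R * R)) s1 s2 s3 s4 :
  compact Q -> connected Q -> connected Q' -> Q `&` Q' = set0 ->
  Q `&` G = set0 -> Q' `&` G = set0 ->
  0 <= s1 -> s1 < s2 -> s2 < s3 -> s3 < s4 -> s4 < 1 ->
  Q (g s1) -> Q' (g s2) -> Q (g s3) -> Q' (g s4) -> False.
Proof.
move=> kQ cQ cQ' QQ' QG Q'G s10 s12 s23 s34 s41 Q1 Q2 Q3 Q4.
(* [B] runs through the closing point of the curve. The two arcs share only [g s1] and [g s3], both
   in [Q]; so the sets [Q] with [A] and [Q] with [B] intersect exactly in the continuum [Q]. *)
pose A := g @` `[s1, s3]; pose B := g @` `[s3, 1] `|` g @` `[0, s1].
have kA : compact A by apply: curve_compact; lra.
have kB : compact B by apply: compactU; apply: curve_compact; lra.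
have clQ := plane_compact_closed kQ.
have clA : closed (Q `|` A) by apply: closedU => //; exact: plane_compact_closed.
have clB : closed (Q `|` B) by apply: closedU => //; exact: plane_compact_closed.
have JAB : J `<=` A `|` B.
  move=> z [x + <-]; rewrite /= in_itv /= => /andP[x0 x1].
  have [xs|xs] := leP x s1; first by right; right; exists x => //; rewrite /= in_itv /= x0.
  have [xs'|xs'] := leP x s3.
    by left; exists x => //; rewrite /= in_itv /= xs' ltW.
  by right; left; exists x => //; rewrite /= in_itv /= x1 ltW.
have AJ : A `<=` J by apply: image_subset; apply: subsegment; lra.
have BJ : B `<=` J by move=> z [|]; apply: image_subset; apply: subsegment; lra.
have capAB z : A z -> B z -> Q z.
  move=> [x + <-]; rewrite /= in_itv /= => /andP[sx xs].
  case=> [|] [y +]; rewrite /= in_itv /= => /andP[sy ys].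
    move=> gyx; have [x0 xy] : 0 <= x /\ x <= y by lra.
    case: (curve_inj x0 xy ys (esym gyx)) => [xE|[xE yE]].
      by have -> : x = s3 by lra.
    by have -> : x = s1 by lra.
  move=> gyx; have [x1 xy] : x <= 1 /\ y <= x by lra.
  case: (curve_inj sy xy x1 gyx) => [xE|]; last by lra.
  by have -> : x = s1 by lra.
have [ o Go] := G0.
have nQG z : G z -> ~ Q z by move=> Gz Qz; have : set0 z by rewrite -QG.
have nQ'Q z : Q' z -> ~ Q z by move=> Q'z Qz; have : set0 z by rewrite -QQ'.
have nQ'G z : Q' z -> ~ G z by move=> Q'z Gz; have : set0 z by rewrite -Q'G.
have GnA z : G z -> ~ (Q `|` A) z by move=> Gz [/(nQG _ Gz)|/AJ/(interior_off_curve Gz)].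
have GnB z : G z -> ~ (Q `|` B) z by move=> Gz [/(nQG _ Gz)|/BJ/(interior_off_curve Gz)].
pose OO X := [set d | ~ (Q `|` X) d /\ linked (Q `|` X) d o].
have oOO X : closed (Q `|` X) -> open (OO X).
  move=> clX; rewrite openE => d [nXd ld]; rewrite /interior.
  have nX : \forall v \near d, ~ (Q `|` X) v.
    by apply: open_nbhs_nbhs; split => //; exact: closed_openC.
  near=> v; split; first by near: v.
  by apply: linked_trans ld; near: v; exact: linked_near.
have GO X : closed (Q `|` X) -> (forall z, G z -> ~ (Q `|` X) z) -> G `<=` OO X.
  move=> clX GX z Gz; split; first exact: GX.
  apply: (linked_connected (C := G)) => //.
  by apply/seteqP; split=> // w [/GX].
have clGO X z : closed (Q `|` X) -> (forall z, G z -> ~ (Q `|` X) z) ->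
    closure G z -> ~ (Q `|` X) z -> OO X z.
  move=> clX GX clz nXz; split => //.
  have nX : nbhs z [set v | linked (Q `|` X) v z] by exact: linked_near.
  have [w [Gw wz]] := clz _ nX.
  by apply: linked_trans (linkedC wz) _; have [] := GO _ clX GX _ Gw.
have A_OB z : Q' z -> A z -> OO B z.
  move=> Q'z Az; apply: clGO => //; first exact/jordan_sub_closure/AJ.
  by case=> [|Bz]; [exact: nQ'Q|apply: (nQ'Q _ Q'z); exact: capAB].
have B_OA z : Q' z -> B z -> OO A z.
  move=> Q'z Bz; apply: clGO => //; first exact/jordan_sub_closure/BJ.
  by case=> [|Az]; [exact: nQ'Q|apply: (nQ'Q _ Q'z); exact: capAB].
(* Gluing over [Q] would link [z] to [o] off a compact set containing all of [J], although [z] is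
   outside [G]. *)
have disj z : Q' z -> OO A z -> OO B z -> False.
  move=> Q'z [nAz lA] [nBz lB].
  have QA : Q (g s1) /\ A (g s1) by split=> //; exists s1 => //; rewrite /= in_itv /= lexx; lra.
  have cap : (Q `|` A) `&` (Q `|` B) = Q.
    rewrite -setUIr; apply/seteqP; split=> [w [//|[Aw Bw]]|w]; last by left.
    exact: capAB.
  have : linked ((Q `|` A) `|` (Q `|` B)) o z.
    apply: linked_glue; rewrite ?cap //; first by exists (g s1).
    - exact: nQ'Q.
    - exact: linkedC.
    - exact: linkedC.
  apply: (@not_linked _ _ G o z b) => //.
  - by apply: compactU; exact: compactU.
  - move=> w /clG [|/JAB]; first by left.
    by case=> [Aw|Bw]; right; [left|right]; right.
  - exact: nQ'G.
  - by case.
pose P := Q' `&` OO B.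
suff PE : P = Q'.
  have [_ O4] : P (g s4) by rewrite PE.
  apply: (disj (g s4)) => //; apply: B_OA => //; left.
  by exists s4 => //; rewrite /= in_itv /=; apply/andP; lra.
apply: cQ'.
- exists (g s2); split => //; apply: A_OB => //.
  by exists s2 => //; rewrite /= in_itv /=; apply/andP; lra.
- by exists (OO B) => //; exact: oOO.
(* A limit point on [B] has a neighbourhood in [OO A], which by [disj] contains no point of [P]. Off
   [B], a limit point is linked to a nearby point of [P], hence to [o]. *)
- exists (closure P); first exact: closed_closure.
  apply/seteqP; split=> z [Q'z]; first by move=> Oz; split => //; exact: subset_closure.
  move=> clz; split => //; have [QBz|nQBz] := pselect ((Q `|` B) z).
    have Bz : B z by case: QBz => // /(nQ'Q _ Q'z).
    have nO : nbhs z (OO A) by apply: open_nbhs_nbhs; split; [exact: oOO|exact: B_OA].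
    have [w [[Q'w OBw] OAw]] := clz _ nO.
    by case: (disj w).
  have nX : nbhs z [set v | linked (Q `|` B) v z] by exact: linked_near.
  have [w [[_ [_ wo]] wz]] := clz _ nX.
  by split => //; exact: linked_trans (linkedC wz) wo.
Unshelve. all: by end_near. Qed.

(** Disjointness makes the two parameters of each pair distinct. Two of the three comparisons agree,
    and two pairs ordered alike are interleaved. *)
Lemma no_three_crossings (Q Q' : set (R * R)) r r' s s' t t' :
  compact Q -> connected Q -> compact Q' -> connected Q' -> Q `&` Q' = set0 ->
  Q `&` G = set0 -> Q' `&` G = set0 ->
  0 <= r -> 0 <= r' -> r < s -> r < s' -> r' < s -> r' < s' ->
  s < t -> s < t' -> s' < t -> s' < t' -> t < 1 -> t' < 1 ->
  Q (g r) -> Q (g s) -> Q (g t) -> Q' (g r') -> Q' (g s') -> Q' (g t') -> False.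
Proof.
move=> kQ cQ kQ' cQ' QQ' QG Q'G r0 r'0 rs rs' r's r's' st st' s't s't' t1 t'1.
move=> Qr Qs Qt Q'r Q's Q't.
have Q'Q : Q' `&` Q = set0 by rewrite setIC.
have neq x y : Q (g x) -> Q' (g y) -> x < y \/ y < x.
  move=> Qx Qy; have [xy|xy|xy] := ltgtP x y; [by left|by right|].
  by have : set0 (g x) by rewrite -QQ'; split => //; rewrite xy.
have i := no_interleaving kQ cQ cQ' QQ' QG Q'G.
have i' := no_interleaving kQ' cQ' cQ Q'Q Q'G QG.
case: (neq _ _ Qr Q'r) => ?; case: (neq _ _ Qs Q's) => ?; case: (neq _ _ Qt Q't) => ?.
- by apply: (i r r' s s') => //; lra.
- by apply: (i r r' s s') => //; lra.
- by apply: (i r r' t t') => //; lra.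
- by apply: (i' s' s t' t) => //; lra.
- by apply: (i s s' t t') => //; lra.
- by apply: (i' r' r t' t) => //; lra.
- by apply: (i' r' r s' s) => //; lra.
- by apply: (i' r' r s' s) => //; lra.
Qed.

End Interior.

End JordanCurve.

(** * Reduction of the sphere to the plane *)

Section Inversion.
Context {R : realType}.
Implicit Types (c u v w z : R * R) (s : sphere R).

Definition inv (v : R * R) : R * R := (v.1 / dot v v, v.2 / dot v v).

Lemma dot_inv v : v != 0 -> dot (inv v) (inv v) = (dot v v)^-1.
Proof.
move=> /dot_gt0 v0; have vn : dot v v != 0 by rewrite gt_eqF.
rewrite {1}/dot /inv /=; transitivity (dot v v * (dot v v)^-1 * (dot v v)^-1).
  by rewrite {5}/dot; lra.
by rewrite mulfV // mul1r.
Qed.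

Lemma inv_inj u v : u != 0 -> v != 0 -> inv u = inv v -> u = v.
Proof.
move=> u0 v0 uv; have duv : dot u u = dot v v.
  by apply: invr_inj; rewrite -!dot_inv // uv.
have dv : (dot v v)^-1 != 0 by rewrite invr_eq0 gt_eqF // dot_gt0.
case: uv; rewrite duv => /(mulIf dv) e1 /(mulIf dv) e2.
by rewrite [u]surjective_pairing e1 e2 -surjective_pairing.
Qed.

Lemma inv_neq0 v : v != 0 -> inv v != 0.
Proof.
move=> v0; apply/eqP => i0; have := dot_inv v0; rewrite i0.
rewrite /dot /= mulr0 addr0 => /esym/eqP.
by rewrite invr_eq0 gt_eqF // (dot_gt0 v0).
Qed.

(* Inversion centred at [c]; the value at [c] itself is the junk value [0]. *)
Definition sphere_inv c (s : sphere R) : R * R :=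
  if s is Some z then inv (z - c) else 0.

Lemma sphere_inv_inj c s s' : s <> Some c -> s' <> Some c ->
  sphere_inv c s = sphere_inv c s' -> s = s'.
Proof.
have nz z : Some z <> Some c :> sphere R -> z - c != 0.
  by move=> zc; rewrite subr_eq0; apply/eqP => zc'; apply: zc; rewrite zc'.
case: s s' => [z|] [z'|] //= sc s'c.
- by move/(inv_inj (nz _ sc) (nz _ s'c))/addIr => ->.
- by move/eqP; rewrite (negbTE (inv_neq0 (nz _ sc))).
- by move/esym/eqP; rewrite (negbTE (inv_neq0 (nz _ s'c))).
Qed.

Lemma sphere_inv_continuous c s : s <> Some c ->
  {for s, continuous (sphere_inv c)}.
Proof.
case: s => [z zc|_]; rewrite /prop_for /continuous_at.
  have z0 : z - c != 0.
    by rewrite subr_eq0; apply/eqP => zc'; apply: zc; rewrite zc'.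
  have cs : (w - c) @[w --> z] --> z - c by exact: continuous_subl.
  have : inv (w - c) @[w --> z] --> inv (z - c).
    have [c1 c2] := (cvg_coords _ _ _).1 cs.
    have cd : (dot (w - c) (w - c))^-1 @[w --> z] --> (dot (z - c) (z - c))^-1.
      apply: cvgV; first by rewrite gt_eqF // dot_gt0.
      by apply: dot_cvg.
    by apply/cvg_coords; split; apply: cvgM.
  by [].
move=> V /nbhs_cbox [e e0 eV].
exists (cbox c e^-1).
  by split; [|apply: plane_compact_closed]; exact: cbox_compact.
move=> _ [[z /= zc <-]|-> /=]; last first.
  by apply: eV; split; rewrite subrr normr0 ltW.
apply: eV.
have n0 : 0 < dot (z - c) (z - c).
  apply: dot_gt0; rewrite subr_eq0; apply/eqP => zE; apply: zc.
  by rewrite zE; split; rewrite subrr normr0 invr_ge0 ltW.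
(* A coordinate larger than 1/e, squared and multiplied by [e], dominates both coordinates. *)
have key (x y : R) : e^-1 < `|x| \/ e^-1 < `|y| -> `|x| <= e * (x * x + y * y).
  have sq (a : R) : a * a = `|a| * `|a| by rewrite -!expr2 real_normK ?num_real.
  have ee : e * e^-1 = 1 by rewrite mulfV // gt_eqF.
  rewrite (sq x) (sq y); have := normr_ge0 x; have := normr_ge0 y.
  move: (`|x|) (`|y|) (e^-1) ee => X Y E eE Y0 X0.
  have E0 : 0 < E by rewrite -(pmulr_rgt0 _ e0) eE.
  have [XE|XE] := ltP E X.
    move=> _; have : X * 1 <= X * (e * X) by rewrite ler_wpM2l // -eE ler_pM2l // ltW.
    have : 0 <= e * (Y * Y) by rewrite !mulr_ge0 // ltW.
    by lra.
  case=> // YE.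
  have : Y * 1 <= Y * (e * Y) by rewrite ler_wpM2l // -eE ler_pM2l // ltW.
  have : 0 <= e * (X * X) by rewrite !mulr_ge0 // ltW.
  by lra.
have big : e^-1 < `|z.1 - c.1| \/ e^-1 < `|z.2 - c.2|.
  have [|h1] := ltP e^-1 `|z.1 - c.1|; first by left.
  by have [|h2] := ltP e^-1 `|z.2 - c.2|; [right|case: zc].
split; rewrite subr0 /= normrM normfV (gtr0_norm n0) ler_pdivrMr //; first exact: key.
by rewrite /dot [X in _ * X]addrC; apply: key; case: big; [right|left].
Qed.

(** Keeps the bounded domain of an inverted curve away from the centre. Within 1 / (4 b) of it, [b]
    times the squared norm is at most a quarter of |x| + |y|, whereas an image in the box would make
    it at least half. *)
Lemma sphere_inv_near_center c (b : R) : 0 < b ->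
  \forall s \near (Some c : sphere R), s <> Some c -> ~ cbox 0 b (sphere_inv c s).
Proof.
move=> b0; pose V := cbox c (4 * b)^-1.
have : nbhs (Some c : sphere R) (Some @` V).
  apply: one_point_compactification_some_nbhs; apply/nbhs_cbox.
  by exists (4 * b)^-1 => //; rewrite invr_gt0 mulr_gt0.
apply: filterS => _ [z [z1 z2] <-] zc [].
have z0 : z - c != 0.
  by rewrite subr_eq0; apply/eqP => zc'; apply: zc; rewrite zc'.
have n0 := dot_gt0 z0.
rewrite !subr0 /= !normrM normfV (gtr0_norm n0) !ler_pdivrMr // => i1 i2.
move: z1 z2 i1 i2 n0; rewrite /dot /=.
have sq (a : R) : a * a = `|a| * `|a| by rewrite -!expr2 real_normK ?num_real.
rewrite (sq (z.1 - c.1)) (sq (z.2 - c.2)); 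
have := normr_ge0 (z.1 - c.1); have := normr_ge0 (z.2 - c.2).
have : (4 * b) * (4 * b)^-1 = 1 by rewrite mulfV // gt_eqF // mulr_gt0.
move: (`|_|) (`|_|) ((4 * b)^-1) => X Y E bE Y0 X0 XE YE XN YN N0.
have bX : 4 * b * X <= 1.
  by have : 4 * b * X <= 4 * b * E; [rewrite ler_pM2l // mulr_gt0|rewrite bE].
have bY : 4 * b * Y <= 1.
  by have : 4 * b * Y <= 4 * b * E; [rewrite ler_pM2l // mulr_gt0|rewrite bE].
have : X * (4 * b * X) <= X * 1 by rewrite ler_wpM2l.
have : Y * (4 * b * Y) <= Y * 1 by rewrite ler_wpM2l.
have : 0 < b * (X * X + Y * Y) by rewrite mulr_gt0.
by lra.
Qed.

Lemma to_sphere_continuous : continuous (@to_sphere R).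
Proof. exact: one_point_compactification_some_continuous. Qed.

Lemma to_sphere_compact_closed (Q : set (plane R)) :
  compact Q -> closed (@to_sphere R @` Q).
Proof.
move=> kQ; have clQ : closed Q by exact: plane_compact_closed.
rewrite -[X in closed X]setCK; apply: open_closedC; rewrite openE => -[z|] nQ.
  rewrite /interior; have : nbhs z (~` Q).
    apply: open_nbhs_nbhs; split; first exact: closed_openC.
    by move=> Qz; apply: nQ; exists z.
  move/one_point_compactification_some_nbhs; apply: filterS.
  by move=> _ [w nQw <-] [v Qv [vw]]; apply: nQw; rewrite -vw.
by exists Q => // _ [[w nQw <-] [v Qv [vw]]|-> [v Qv]] //; apply: nQw; rewrite -vw.
Qed.

(** Provides a centre of inversion. Without one, [U] would avoid infinity, whose neighbourhoods are
    unbounded, and be covered by two disjoint compacta. Each meets [U], since it lies in the closure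
    of [U]; this contradicts connectedness. *)
Lemma sphere_center (U : set (sphere R)) (Q Q' : set (plane R)) :
  open U -> connected U -> compact Q -> compact Q' -> Q `&` Q' = set0 ->
  Q !=set0 -> Q' !=set0 ->
  @to_sphere R @` Q `<=` closure U -> @to_sphere R @` Q' `<=` closure U ->
  exists c, [/\ U (to_sphere c), ~ Q c & ~ Q' c].
Proof.
move=> oU cU kQ kQ' QQ' Q0 Q'0 QU Q'U; apply: contrapT => h.
have clQ := to_sphere_compact_closed kQ; have clQ' := to_sphere_compact_closed kQ'.
have UQQ z : U (to_sphere z) -> Q z \/ Q' z.
  move=> Uz; apply: contrapT => /not_orP[nQ nQ'].
  by apply: h; exists z.
have nUN : ~ U None.
  move=> UN; have : nbhs (None : sphere R) U by exact: open_nbhs_nbhs.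
  case=> W [kW clW] WU.
  have [b b0 Bb] := compact_sub_cbox (compactU (compactU kQ kQ') kW).
  pose z : plane R := (b + 1, 0).
  have nz : ~ (Q `|` Q' `|` W) z by move=> /Bb[/=]; rewrite subr0 ger0_norm; lra.
  have : U (to_sphere z) by apply: WU; left; exists z => // Wz; apply: nz; right.
  by move=> /UQQ QQ; apply: nz; left.
have meet P P' : P !=set0 -> (@to_sphere R @` P `<=` closure U) ->
    closed (@to_sphere R @` P') -> P `&` P' = set0 ->
    (forall z, U (to_sphere z) -> P z \/ P' z) ->
    exists2 z, P z & U (to_sphere z).
  move=> [z Pz] PU clP' PP' UPP.
  have : nbhs (to_sphere z) (~` (@to_sphere R @` P')).
    apply: open_nbhs_nbhs; split; first exact: closed_openC.
    move=> [w P'w [wz]]; have : set0 z by rewrite -PP'; split => //; rewrite -wz.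
    by [].
  have /PU clz : (@to_sphere R @` P) (to_sphere z) by exists z.
  move=> /clz [[w|] [Uw nP'w]] //; exists w => //.
  by case: (UPP _ Uw) => // P'w; case: nP'w; exists w.
have [z Qz Uz] := meet _ _ Q0 QU clQ' QQ' UQQ.
have Q'Q : Q' `&` Q = set0 by rewrite setIC.
have [w Q'w Uw] : exists2 z, Q' z & U (to_sphere z).
  by apply: (meet _ Q) => // v /UQQ; tauto.
have BU : U `&` @to_sphere R @` Q = U.
  apply: cU; first by exists (to_sphere z); split => //; exists z.
    exists (~` (@to_sphere R @` Q')); first exact: closed_openC.
    apply/seteqP; split=> -[v|] [Uv] //.
      move=> [x Qx [xv]]; split => // -[y Q'y [yv]].
      by have : set0 x by rewrite -QQ'; split => //; rewrite xv -yv.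
    by move=> nQ'v; split => //; case: (UQQ _ Uv) => // [Qv|Q'v];
      [exists v|case: nQ'v; exists v].
  by exists (@to_sphere R @` Q).
have [_ [x Qx [xw]]] : (U `&` @to_sphere R @` Q) (to_sphere w) by rewrite BU.
by have : set0 w by rewrite -QQ'; split => //; rewrite -xw.
Qed.

(** After inversion about a point of [U], the bounded domain of the image curve pulls back to an
    open set [V] disjoint from [U]: its part in [U] is relatively clopen and omits the centre. The
    continua, lying in the closure of [U], then avoid [V] too. *)
Lemma sphere_no_three_crossings (gam : R -> sphere R) (U : set (sphere R))
    (Q Q' : set (plane R)) (r r' s s' t t' : R) :
  {within `[0, 1], continuous gam} -> gam 0 = gam 1 ->
  {in `[0, 1[ &, injective gam} ->
  open U -> connected U -> U `&` (gam @` `[0, 1]) = set0 ->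
  compact Q -> connected Q -> compact Q' -> connected Q' -> Q `&` Q' = set0 ->
  @to_sphere R @` Q `<=` closure U -> @to_sphere R @` Q' `<=` closure U ->
  0 <= r -> 0 <= r' -> r < s -> r < s' -> r' < s -> r' < s' ->
  s < t -> s < t' -> s' < t -> s' < t' -> t < 1 -> t' < 1 ->
  (@to_sphere R @` Q) (gam r) -> (@to_sphere R @` Q) (gam s) ->
  (@to_sphere R @` Q) (gam t) -> (@to_sphere R @` Q') (gam r') ->
  (@to_sphere R @` Q') (gam s') -> (@to_sphere R @` Q') (gam t') -> False.
Proof.
move=> cg g01 ig oU cU UJ kQ cQ kQ' cQ' QQ' QU Q'U r0 r'0 rs rs' r's r's' st st' s't s't' t1 t'1.
move=> Qr Qs Qt Q'r Q's Q't.
have Q0 : Q !=set0 by case: Qr => z Qz _; exists z.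
have Q'0 : Q' !=set0 by case: Q'r => z Qz _; exists z.
have [c [Uc nQc nQ'c]] := sphere_center oU cU kQ kQ' QQ' Q0 Q'0 QU Q'U.
pose phi := sphere_inv c; pose g := phi \o gam.
have gc (x : R) : 0 <= x <= 1 -> gam x <> Some c.
  by move=> x01 gx; have : set0 (gam x) by rewrite -UJ; split; [rewrite gx|exists x].
have in01 (x : R) : 0 <= x < 1 -> 0 <= x <= 1 by move=> /andP[-> /ltW].
have cphi (x : sphere R) : x <> Some c -> {for x, continuous phi} by exact: sphere_inv_continuous.
have cg' : {within `[0, 1], continuous g}.
  apply/subspace_continuousP => x x01.
  have cx : gam @ within `[0, 1] (nbhs x) --> gam x by move/subspace_continuousP: cg; exact.
  apply: (cvg_comp _ _ cx); apply: cphi; exact: gc.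
have g01' : g 0 = g 1 by rewrite /g /= g01.
have ig' : {in `[0, 1[ &, injective g}.
  move=> x y x01 y01 gxy; apply: ig => //; apply: sphere_inv_inj gxy; apply: gc.
    by apply: in01; move: x01; rewrite in_itv.
  by apply: in01; move: y01; rewrite in_itv.
have [G [b [[oG cG] G0 Gb GJ clG]]] := jordan_interior cg' g01' ig'.
have b0 : 0 < b by have [z /Gb[+ _]] := G0; apply: le_lt_trans.
pose V := [set s : sphere R | s <> Some c /\ G (phi s)].
have oV : open V.
  rewrite openE => x [xc Gx]; rewrite /interior.
  have : nbhs (phi x) G by exact: open_nbhs_nbhs.
  move/(cphi _ xc) => nG; rewrite nbhs_simpl /= in nG.
  have : nbhs x (~` (@to_sphere R @` [set c])).
    apply: open_nbhs_nbhs; split; last by move=> [z -> /esym].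
    by apply: closed_openC; apply: to_sphere_compact_closed; exact: compact_set1.
  by apply: filterS2 nG => y Gy yc; split => // yE; apply: yc; exists c.
have UV : U `&` V = set0.
  apply: contrapT => /eqP/set0P UV0.
  suff UVU : U `&` V = U by have [_ []] : (U `&` V) (to_sphere c) by rewrite UVU.
  apply: cU => //; first by exists V.
  exists (closure V); first exact: closed_closure.
  apply/seteqP; split=> x [Ux]; first by move=> Vx; split => //; exact: subset_closure.
  move=> clx; split => //.
  (* The centre is no limit of [V], as values near it leave every box. Any other limit of [V] maps
     into the closure of [G], and frontier points come from the curve, which is off [U]. *)
  have [xc|xc] := pselect (x = Some c).
    have := sphere_inv_near_center c b0; rewrite -xc => /clx [y [[yc Gy]]].
    rewrite xc => /(_ yc) []; have [y1 y2] := Gb _ Gy.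
    by split; rewrite subr0 ltW.
  have : closure G (phi x).
    move=> W /(cphi _ xc) nW; rewrite nbhs_simpl /= in nW.
    by have [y [[_ Gy] Wy]] := clx _ nW; exists (phi y).
  move=> /clG [Gx|[y y01 yx]]; first by split.
  have : set0 x.
    rewrite -UJ; split => //; exists y => //.
    by apply: sphere_inv_inj yx => //; exact: gc.
  by [].
have QG P : @to_sphere R @` P `<=` closure U -> ~ P c ->
    (phi \o @to_sphere R) @` P `&` G = set0.
  move=> PU nPc; apply/seteqP; split=> // _ [[z Pz <-] Gz].
  have Vz : V (to_sphere z).
    by split => // -[zc]; apply: nPc; rewrite -zc.
  have /PU clz : (@to_sphere R @` P) (to_sphere z) by exists z.
  have [y] : U `&` V !=set0 by apply: clz; exact: open_nbhs_nbhs.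
  by rewrite UV.
have cphiP (P : set (plane R)) : ~ P c -> {within P, continuous (phi \o @to_sphere R)}.
  move=> nPc; apply: continuous_in_subspaceT => z; rewrite inE => Pz.
  apply: (@continuous_comp _ _ _ (@to_sphere R) phi); first exact: to_sphere_continuous.
  by apply: cphi => -[zc]; apply: nPc; rewrite -zc.
have mem (P : set (plane R)) x : (@to_sphere R @` P) (gam x) ->
    ((phi \o @to_sphere R) @` P) (g x).
  by case=> z Pz zx; exists z => //; rewrite /g /= -zx.
apply: (no_three_crossings cg' g01' ig' oG cG G0 Gb GJ clG
  (Q := (phi \o @to_sphere R) @` Q) (Q' := (phi \o @to_sphere R) @` Q')
  _ _ _ _ _ _ _ r0 r'0 rs rs' r's r's' st st' s't s't' t1 t'1);
  try exact: mem.
- by apply: continuous_compact => //; exact: cphiP.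
- by apply: connected_continuous_connected => //; exact: cphiP.
- by apply: continuous_compact => //; exact: cphiP.
- by apply: connected_continuous_connected => //; exact: cphiP.
- apply/seteqP; split=> // _ [[z Qz <-] [w Q'w wz]].
  have [wz'] : to_sphere w = to_sphere z.
    by apply: sphere_inv_inj wz => -[E]; [apply: nQ'c|apply: nQc]; rewrite -E.
  by have : set0 z by rewrite -QQ'; split => //; rewrite -wz'.
- exact: QG.
- exact: QG.
Qed.

End Inversion.

(** * Continua, monotone maps and Hausdorff limits *)

(* Components of compacta are quasi-components. *)
Lemma component_clopen_nbhd {R : realType} {T : pseudoMetricType R} (C : set T)
    (x : T) (W : set T) : closed C -> compact C -> C x -> open W ->
  connected_component C x `<=` W ->
  exists F O, [/\ closed F, open O, F = C `&` O, F x & F `<=` W].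
Proof.
move=> clC kC Cx oW CW.
pose q F := [/\ closed F, F x & exists2 O, open O & F = C `&` O].
have qC : q C by split => //; exists setT; [exact: openT|rewrite setIT].
have qI F G : q F -> q G -> q (F `&` G).
  move=> [cF Fx [ O oO FE]] [cG Gx [ O' oO' GE]]; split; [exact: closedI|by []|].
  by exists (O `&` O'); [exact: openI|rewrite FE GE setIACA setIid].
(* The quasi-component of [x]. Once connected, it lies in the component and so in [W]; by
   compactness some clopen [F] then does as well. *)
pose Z := \bigcap_(F in q) F.
have clZ : closed Z by apply: closed_bigI => F [].
have ZC : Z `<=` C by move=> z; apply.
have shrink V : open V -> Z `<=` V -> exists2 F, q F & F `<=` V.
  move=> oV ZV; apply: contrapT => h.
  pose B := filter_from q (fun F => F `\` V).
  have BF : ProperFilter B.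
    apply: filter_from_proper.
      apply: filter_from_filter; first by exists C.
      by move=> F G qF qG; exists (F `&` G); [exact: qI|move=> z [[Fz Gz] nVz]].
    move=> F qF; apply: contrapT => /nonemptyPn FV; apply: h; exists F => //.
    by rewrite -setD_eq0.
  have BC : B C by exists C => // z [].
  have [z [Cz clz]] := kC B BF BC.
  have nVz : (~` V) z.
    have := open_closedC oV; rewrite closedE; apply => Vz'.
    have [w [[]]] := clz (C `\` V) _ (ltac:(by exists C)) Vz'.
    by move=> _ nV; apply.
  apply: nVz; apply: ZV => F qF; have [clF _ _] := qF.
  move: clF; rewrite closedE; apply => Fz'.
  have [w [[Fw _]]] := clz (F `\` V) _ (ltac:(by exists F)) Fz'.
  by apply.
suff cZ : connected Z.
  have [F [clF Fx [ O oO FE]] FW] : exists2 F, q F & F `<=` W.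
    apply: shrink => //; apply: subset_trans CW; apply: connected_component_max => //.
    by move=> F [].
  by exists F, O.
apply/connectedP => E [E0 ZE [E01 E10]].
have Zx : Z x by move=> F [].
wlog E0x : E E0 ZE E01 E10 / E false x.
  move=> wl; move: (Zx); rewrite ZE => -[Ex|Ex]; first exact: (wl E).
  by apply: (wl (E \o negb)) => /=;
    [move=> ?; exact: E0|rewrite setUC|rewrite setIC|rewrite setIC|].
have cE b : closed (E b).
  have -> : E b = Z `&` closure (E b).
    rewrite ZE setIUl; case: b.
      by rewrite E10 set0U; apply/esym/setIidPl; exact: subset_closure.
    rewrite [E true `&` _]setIC E01 setU0.
    by apply/esym/setIidPl; exact: subset_closure.
  by apply: closedI => //; exact: closed_closure.
have E00 : E false `&` E true = set0.
  by apply: separated_disjoint; split.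
have [u [cu u0 u1 _]] := @urysohn_ext_itv _ R (@pseudometric_normal R T)
  _ _ 0 1 (cE false) (cE true) E00 ltr01.
have u0E z : E false z -> u z = 0 by move=> Ez; apply: u0; exists z.
have u1E z : E true z -> u z = 1 by move=> Ez; apply: u1; exists z.
pose V0 := u @^-1` [set r | r < 1 / 2]; pose V1 := u @^-1` [set r | 1 / 2 < r].
have oV0 : open V0 by apply: open_comp; [move=> z _; exact: cu|exact: open_lt].
have oV1 : open V1 by apply: open_comp; [move=> z _; exact: cu|exact: open_gt].
have [|F qF FV] := shrink (V0 `|` V1) (openU oV0 oV1).
  rewrite ZE => z [Ez|Ez].
    by left; rewrite /V0 /= u0E //; lra.
  by right; rewrite /V1 /= u1E //; lra.
have [clF Fx [ O oO FE]] := qF.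
(* On [F] the function [u] never equals 1/2, so the cut there is relatively clopen. It keeps [x] but
   loses [E true], although [Z] lies in every such set. *)
have qFV : q (F `&` V0).
  split.
  - rewrite (_ : F `&` V0 = F `&` u @^-1` [set r | r <= 1 / 2]).
      apply: closedI => //; apply: preimage_closed; last exact: closed_le.
      by move=> z _; exact: cu.
    apply/seteqP; split=> z [Fz]; first by move=> /ltW.
    by rewrite /= => uz; split => //; case: (FV _ Fz) => //; rewrite /V1 /=; lra.
  - by split => //; rewrite /V0 /= u0E //; lra.
  - by exists (O `&` V0); [exact: openI|rewrite FE setIA].
have [z Ez] := E0 true.
have Zz : Z z by rewrite ZE; right.
have [_] := Zz _ qFV; rewrite /V0 /= u1E //; lra.
Qed.

(* Boundary bumping: otherwise a clopen neighbourhood of the component in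
   [K `&` D] would cut a proper clopen part out of [A]. *)
Lemma continuum_escape {R : realType} {T : pseudoMetricType R}
    (K D W A : set T) (a a' : T) : hausdorff_space T ->
  compact K -> closed D -> open W -> W `<=` D ->
  compact A -> connected A -> A `<=` K -> A a -> (K `&` D) a -> A a' ->
  ~ connected_component (K `&` D) a a' ->
  exists e, [/\ connected_component (K `&` D) a e, A e & ~ W e].
Proof.
move=> hT kK clD oW WD kA cA AK Aa Ca Aa' na'; apply: contrapT => h.
have clK := compact_closed hT kK; have clA := compact_closed hT kA.
have clC : closed (K `&` D) by exact: closedI.
have kC : compact (K `&` D) by apply: (subclosed_compact clC kK) => z [].
pose O1 := ~` (((K `&` D) `&` A) `&` ~` W) `&` ~` [set a'].
have oO1 : open O1.
  apply: openI; apply: closed_openC; last first.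
    exact: (compact_closed hT (@compact_set1 _ a')).
  by apply: closedI; [exact: closedI|exact: open_closedC].
have sO1 : connected_component (K `&` D) a `<=` O1.
  move=> z az; split; last by move=> za'; apply: na'; rewrite -za'.
  by move=> [[_ Az] nWz]; apply: h; exists z.
have [F [ O [clF oO FE Fa FO1]]] := component_clopen_nbhd clC kC Ca oO1 sO1.
(* By the choice of [O1], points of [A] in [F] lie in the open set [W], hence [F] is relatively open
   in [A] and not just in [K] cut by [D]. But [F] omits [a']. *)
have FA : A `&` F = A.
  apply: cA; first by exists a.
    exists (O `&` W); first exact: openI.
    apply/seteqP; split=> z [Az].
      move=> Fz; have [Cz Oz] : (K `&` D `&` O) z by rewrite -FE.
      split => //; split => //; have [nz _] := FO1 _ Fz.
      by apply: contrapT => nWz; apply: nz.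
    move=> [ Oz Wz]; split => //; rewrite FE; split => //; split; first exact: AK.
    exact: WD.
  by exists F.
have [_ /FO1[_]] : (A `&` F) a' by rewrite FA.
by apply.
Qed.

(** Connected fibres make a relatively clopen part [B] saturated. By compactness [B] and the rest
    have closed images, disjoint and covering the connected set [V]. *)
Lemma monotone_preimage_connected {T Y : topologicalType} (K : set T)
    (F : T -> Y) (V : set Y) : hausdorff_space Y -> compact K ->
  {within K, continuous F} ->
  (forall y, V y -> connected (K `&` F @^-1` [set y])) ->
  V `<=` F @` K -> compact (K `&` F @^-1` V) -> connected V ->
  connected (K `&` F @^-1` V).
Proof.
move=> hY kK cF fib VF kA cV B [z Bz] [ O oO BO] [C clC BC].
set A := K `&` F @^-1` V in kA BO BC *.
have BA : B `<=` A by rewrite BO => w [].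
have AK : A `<=` K by move=> w [].
have clFim X : compact X -> X `<=` A -> closed (F @` X).
  move=> kX XA; apply: compact_closed => //; apply: continuous_compact => //.
  by apply: continuous_subspaceW cF => w /XA[].
have kB : compact B by rewrite BC; exact: compact_closedI.
have kB' : compact (A `\` B).
  have -> : A `\` B = A `&` ~` O.
    apply/seteqP; split=> w [Aw nw]; split => //.
      by move=> Ow; apply: nw; rewrite BO.
    by rewrite BO => -[].
  by apply: compact_closedI => //; exact: open_closedC.
have sat w v : A w -> B v -> F w = F v -> B w.
  move=> [Kw Vw] Bv wv; have [Kv Vv] := BA _ Bv.
  have : (K `&` F @^-1` [set F w]) `&` B = K `&` F @^-1` [set F w].
    apply: (fib _ Vw); first by exists v; rewrite /= wv.
      exists O => //; apply/seteqP; split=> u [[Ku /= Fu] Bu]; split => //.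
        by move: Bu; rewrite BO => -[].
      by rewrite BO; split => //; split => //; rewrite /= Fu.
    exists C => //; apply/seteqP; split=> u [[Ku /= Fu] Bu]; split => //.
      by move: Bu; rewrite BC => -[].
    by rewrite BC; split => //; split => //; rewrite /= Fu.
  by move=> e; have [] : ((K `&` F @^-1` [set F w]) `&` B) w by rewrite e.
have FB : F @` B = V.
  apply: cV; first by exists (F z), z.
    exists (~` (F @` (A `\` B))).
      by apply: closed_openC; apply: clFim => // w [].
    apply/seteqP; split=> y.
      move=> [w Bw <-]; split; first by have [] := BA _ Bw.
      by move=> [v [Av nBv] vw]; apply: nBv; exact: sat vw.
    move=> [Vy ny]; have [w Kw wy] := VF _ Vy; exists w => //.
    apply: contrapT => nBw; apply: ny; exists w => //; split => //.
    by split => //; rewrite /= wy.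
  exists (F @` B); first exact: clFim.
  apply/seteqP; split=> [y [w Bw <-]|y []//]; split; last by exists w.
  by have [] := BA _ Bw.
apply/seteqP; split => // w Aw.
have [v Bv vw] : (F @` B) (F w) by rewrite FB; case: Aw.
exact: sat (esym vw).
Qed.

(** * Limits in the Hausdorff distance *)

Section HausdorffLimits.
Context {R : realType}.
Implicit Types (A B L E : set (plane R)) (a b z : plane R).

Lemma coords_le_edist a b (e : R) : Defs.edist a b < e ->
  `|b.1 - a.1| < e /\ `|b.2 - a.2| < e.
Proof.
move=> abe; split; apply: le_lt_trans abe; rewrite distrC -sqrtr_sqr ler_wsqrtr //.
  by rewrite lerDl sqr_ge0.
by rewrite lerDr sqr_ge0.
Qed.

Lemma hausdorff_dist_lt A B (e : R) : (hausdorff_dist A B < e%:E)%E ->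
  (forall a, A a -> exists2 b, B b & Defs.edist a b < e) /\
  (forall b, B b -> exists2 a, A a & Defs.edist a b < e).
Proof.
rewrite /hausdorff_dist gt_max => /andP[hA hB]; split=> [a Aa|b Bb].
  have /ereal_inf_lt [_ [b Bb <-]] :
      (ereal_inf [set (Defs.edist a b)%:E | b in B] < e%:E)%E.
    by apply: le_lt_trans hA; apply: ereal_sup_ubound; exists a.
  by rewrite lte_fin; exists b.
have /ereal_inf_lt [_ [a Aa <-]] :
    (ereal_inf [set (Defs.edist a b)%:E | a in A] < e%:E)%E.
  by apply: le_lt_trans hB; apply: ereal_sup_ubound; exists b.
by rewrite lte_fin; exists a.
Qed.

Variables (Q : nat -> set (plane R)) (L : set (plane R)).
Hypothesis QL : hausdorff_dist (Q n) L @[n --> \oo] --> 0%E.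

Lemma hausdorff_near (e : R) : 0 < e ->
  exists N, forall n, (N <= n)%N -> (hausdorff_dist (Q n) L < e%:E)%E.
Proof.
move=> e0; have : nbhs 0%E [set x | (x < e%:E)%E].
  by apply: open_nbhs_nbhs; split; [exact: open_ereal_lt_ereal|rewrite /= lte_fin].
by move=> /QL [N _ NP]; exists N => n Nn; exact: NP.
Qed.

Lemma hausdorff_lim_meets z (V : set (plane R)) : L z -> nbhs z V ->
  exists N, forall n, (N <= n)%N -> Q n `&` V !=set0.
Proof.
move=> Lz /nbhs_box[e e0 eV]; have [N NP] := hausdorff_near e0.
exists N => n /NP /hausdorff_dist_lt[_ /(_ _ Lz)[a Qa az]].
exists a; split => //; have [a1 a2] := coords_le_edist az.
by apply: eV; rewrite distrC.
Qed.

(** Points chosen in [Q n] and [E] have a cluster point in [E], and it cannot keep a positive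
    distance from [L]. *)
Lemma hausdorff_lim_compact E N : closed L -> compact E ->
  (forall n, (N <= n)%N -> Q n `&` E !=set0) -> L `&` E !=set0.
Proof.
move=> clL kE QE.
have /boolp.choice[s sP] : forall n, exists z, (N <= n)%N -> (Q n `&` E) z.
  move=> n; have [/QE[z]|_] := boolP (N <= n)%N; first by exists z.
  by exists 0.
have sE : (s @ \oo) E by exists N => // n /= /sP[].
have [z [Ez clz]] := kE (s @ \oo) _ sE.
exists z; split => //; apply: contrapT => nLz.
have /nbhs_cbox[e e0 eL] : nbhs z (~` L).
  by apply: open_nbhs_nbhs; split => //; exact: closed_openC.
have e2 : 0 < e / 2 by rewrite divr_gt0.
have [N' NP] := hausdorff_near e2.
have bz : nbhs z (cbox z (e / 2)) by apply/nbhs_cbox; exists (e / 2).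
have sN : (s @ \oo) (s @` [set n | (maxn N N' <= n)%N]).
  by exists (maxn N N') => // n Nn; exists n.
have [_ [[n /= Nn <-] [z1 z2]]] := clz _ _ sN bz.
have [Nn1 Nn2] : (N <= n)%N /\ (N' <= n)%N by move: Nn; rewrite geq_max => /andP.
have [Qs _] := sP _ Nn1.
have [/(_ _ Qs)[b Lb sb] _] := hausdorff_dist_lt (NP _ Nn2).
have [b1 b2] := coords_le_edist sb.
apply: (eL b) Lb; split.
  rewrite -(subrKA (s n).1) (le_trans (ler_normD _ _)) //; lra.
rewrite -(subrKA (s n).2) (le_trans (ler_normD _ _)) //; lra.
Qed.

End HausdorffLimits.

Lemma compact_within_preimage {T U : topologicalType} (K : set T) (F : T -> U)
    (V : set U) : closed K -> compact K -> {within K, continuous F} -> closed V ->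
  compact (K `&` F @^-1` V).
Proof.
move=> clK kK cF clV; apply: (subclosed_compact _ kK); last by move=> z [].
have /closed_subspaceP[C clC CE] : closed (F @^-1` V : set (subspace K)).
  by move/continuous_closedP: cF; exact.
by rewrite setIC -CE; exact: closedI.
Qed.

(** * Images of the late components in the Peano compactum *)

Section MonotoneMaps.
Context {R : realType} (Y : metricType R) (K : set (plane R)) (F : plane R -> Y).
Hypothesis kK : compact K.
Hypothesis cF : {within K, continuous F}.
Hypothesis FK : F @` K = setT.
Hypothesis fib : forall y, connected (K `&` F @^-1` [set y]).
Hypothesis pY : peano_compactum Y.

Let hY : hausdorff_space Y := @metric_hausdorff R Y.

Lemma plane_hausdorff : hausdorff_space (R * R)%type.
Proof. exact: norm_hausdorff. Qed.

Lemma compact_preimage (V : set Y) : closed V -> compact (K `&` F @^-1` V).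
Proof.
by apply: compact_within_preimage => //; exact: plane_compact_closed.
Qed.

Lemma preimage_continuum (V : set Y) : closed V -> connected V ->
  connected (K `&` F @^-1` V).
Proof.
move=> clV cV; apply: monotone_preimage_connected => //.
  by move=> y _; rewrite FK.
exact: compact_preimage.
Qed.

Variables (D W : set (plane R)) (Q : nat -> set (plane R)) (L : set (plane R)).
Hypothesis clD : closed D.
Hypothesis oW : open W.
Hypothesis WD : W `<=` D.
Hypothesis Qinj : injective Q.
Hypothesis Qcomp : forall n, components (D `&` K) (Q n).
Hypothesis kL : compact L.
Hypothesis QL : hausdorff_dist (Q n) L @[n --> \oo] --> 0%E.

Lemma component_of_point n z : Q n z -> Q n = connected_component (D `&` K) z.
Proof.
by have [w _ <-] := Qcomp n => wz; exact: same_connected_component.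
Qed.

Lemma component_sub n : Q n `<=` D `&` K.
Proof. by have [w _ <-] := Qcomp n; exact: connected_component_sub. Qed.

Lemma components_connected n : connected (Q n).
Proof. by have [w _ <-] := Qcomp n; exact: component_connected. Qed.

Lemma components_compact n : compact (Q n).
Proof.
apply: (subclosed_compact _ kK); last by move=> z /component_sub[].
have [w _ <-] := Qcomp n; apply: component_closed.
by apply: closedI => //; exact: plane_compact_closed.
Qed.

Lemma components_disjoint n m : n != m -> Q n `&` Q m = set0.
Proof.
move=> nm; apply/seteqP; split => // z [/component_of_point nz /component_of_point mz].
by move/eqP: nm; apply; apply: Qinj; rewrite nz mz.
Qed.

Lemma limit_closed : closed L. Proof. exact: plane_compact_closed. Qed.

Lemma limit_sub : L `<=` K.
Proof.
move=> z Lz; have clK : closed K := plane_compact_closed kK.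
rewrite (closure_id K).1 // => V /(hausdorff_lim_meets QL Lz)[N NP].
have [w [Qw Vw]] := NP _ (leqnn N).
by exists w; split => //; have [] := component_sub Qw.
Qed.

Lemma near_value z (V : set Y) : L z -> nbhs (F z) V ->
  exists N, forall n, (N <= n)%N -> exists2 w, Q n w & V (F w).
Proof.
move=> Lz FV; have Kz := limit_sub Lz.
move: cF => /subspace_continuousP /(_ z Kz) /(_ V FV) /= nV.
have [N NP] := hausdorff_lim_meets QL Lz nV.
exists N => n /NP [w [Qw h]]; exists w => //; apply: h.
by have [] := component_sub Qw.
Qed.

Lemma image_connected n : connected (F @` Q n).
Proof.
apply: connected_continuous_connected; first exact: components_connected.
by apply: continuous_subspaceW cF => z /component_sub[].
Qed.

(** A late image comes within d/3 of both [F x] and [F y], so its component of [Y] has diameter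
    above d/3. Such components are finitely many; those other than [P] form a closed set missing
    [F x]. *)
Lemma images_in_component x y : L x -> L y -> F x != F y ->
  exists N, forall n, (N <= n)%N -> F @` Q n `<=` connected_component setT (F x).
Proof.
move=> Lx Ly Fxy; pose d := mdist (F x) (F y).
have d0 : 0 < d by rewrite mdist_gt0.
have d3 : 0 < d / 3 by rewrite divr_gt0.
have [kY _ /(_ _ d3) fin] := pY.
set P := connected_component setT (F x).
pose big := [set X | components [set: Y] X /\ ~ (diam X < (d / 3)%:E)%E].
pose B := \bigcup_(X in [set X | big X /\ X <> P]) X.
have clB : closed B.
  apply: closed_bigcup; first by apply: sub_finite_set fin => X [].
  by move=> _ [[[w _ <-] _] _]; apply: component_closed; exact: closedT.
have nBx : ~ B (F x).
  move=> [X [[[w _ wX] _] XP] Xx]; apply: XP; rewrite -wX.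
  by apply: same_connected_component; rewrite wX.
have n1 : nbhs (F x) (ball (F x) (d / 3) `&` ~` B).
  apply: filterI; first exact: nbhsx_ballx.
  by apply: open_nbhs_nbhs; split => //; exact: closed_openC.
have n2 : nbhs (F y) (ball (F y) (d / 3)) by exact: nbhsx_ballx.
have [N1 N1P] := near_value Lx n1; have [N2 N2P] := near_value Ly n2.
exists (maxn N1 N2) => n; rewrite geq_max => /andP[/N1P[a Qa [xa nBa]] /N2P[b Qb yb]].
pose X := connected_component setT (F a).
have QX : F @` Q n `<=` X.
  by apply: connected_component_max => //; exact: image_connected.
suff <- : X = P by [].
apply: contrapT => XP; apply: nBa; exists X; last exact: connected_component_refl.
split => //; split; first by exists (F a).
have : ((mdist (F a) (F b))%:E <= diam X)%E.
  apply: ereal_sup_ubound; exists (F a, F b) => //; split; apply: QX.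
    by exists a.
  by exists b.
move=> abX dX; have := le_lt_trans abX dX; rewrite lte_fin => ab.
move: xa yb; rewrite !ballEmdist /= => xa yb.
have := metric_triangle (F x) (F a) (F y); have := metric_triangle (F a) (F b) (F y).
by rewrite (metric_sym (F b) (F y)) -/d; lra.
Qed.

(** Local connectedness is available only inside a component of [Y], hence the previous localisation
    of the late images. The neighbourhood is replaced by its closure to make the preimage a
    continuum. *)
Lemma escape_near_value x y z (e : R) : L x -> L y -> F x != F y -> L z -> 0 < e ->
  exists N, forall n, (N <= n)%N ->
    exists2 w, Q n w & ~ W w /\ mdist (F z) (F w) <= e.
Proof.
move=> Lx Ly Fxy Lz e0.
have [N1 N1P] := images_in_component Lx Ly Fxy.
set P := connected_component setT (F x) in N1P.
have clP : closed P by apply: component_closed; exact: closedT.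
have [kY /(_ P) pP _] := pY.
have [|kP cP lcP] := pP; first by exists (F x).
have PFz : P (F z).
  apply: contrapT => nP; have nPz : nbhs (F z) (~` P).
    by apply: open_nbhs_nbhs; split => //; exact: closed_openC.
  have [N2 N2P] := near_value Lz nPz.
  have [w Qw] := N2P _ (leq_maxr N1 N2).
  by apply; apply: (N1P _ (leq_maxl N1 N2)); exists w.
pose w0 : P := exist _ (F z) (mem_set PFz).
have nU : nbhs w0 (set_val @^-1` ball (F z) e : set P).
  apply: (@initial_continuous P Y set_val w0); exact: nbhsx_ballx.
have [V [oV cV Vw0 VU]] := lcP w0 _ nU.
pose V1 := set_val @` V; pose V' := closure V1.
have cV' : connected V'.
  apply: connected_closure; apply: connected_continuous_connected => //.
  by apply: continuous_subspaceT; exact: initial_continuous.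
have V'e v : V' v -> mdist (F z) v <= e.
  move=> V'v; rewrite leNgt; apply/negP => ev.
  have : nbhs v (ball v (mdist (F z) v - e)) by apply: nbhsx_ballx; rewrite subr_gt0.
  move=> /V'v [_ [[u Vu <-]]]; have := VU _ Vu; rewrite /= !ballEmdist /= => zu vu.
  have := metric_triangle (F z) (set_val u) v; rewrite (metric_sym (set_val u) v).
  by lra.
case: oV => O oO OV.
have nO : nbhs (F z) O.
  by apply: open_nbhs_nbhs; split => //; move: Vw0; rewrite -OV.
have [N2 N2P] := near_value Lz nO.
have meet n : (maxn N1 N2 <= n)%N -> exists2 w, Q n w & (K `&` F @^-1` V') w.
  rewrite geq_max => /andP[n1 /N2P[w Qw Ow]]; exists w => //.
  split; first by have [] := component_sub Qw.
  have Pw : P (F w) by apply: (N1P n n1); exists w.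
  apply: subset_closure; exists (exist _ (F w) (mem_set Pw)) => //.
  by rewrite -OV.
exists (maxn N1 N2) => n Nn.
(* The next component [Q n.+1] serves as the place that the preimage continuum reaches outside
   [Q n]. *)
have [a Qa Aa] := meet _ Nn; have [a' Qa' Aa'] := meet _ (leqW Nn).
have := @continuum_escape _ _ K D W (K `&` F @^-1` V') a a' plane_hausdorff
  kK clD oW WD (compact_preimage (@closed_closure _ _))
  (preimage_continuum (@closed_closure _ _) cV').
have Ca : (K `&` D) a by rewrite setIC; exact: component_sub Qa.
rewrite [K `&` D]setIC -(component_of_point Qa) in Ca *.
case=> //.
  move=> Qna'; have : (Q n `&` Q n.+1) a' by [].
  by rewrite components_disjoint // neq_ltn leqnn.
by move=> w [Qw [_ /V'e we] nWw]; exists w.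
Qed.

(** Every late image is connected and comes near both ends, so it takes the distance [v];
    compactness of the level set carries this to [L]. *)
Lemma intermediate_value x y (v : R) : L x -> L y -> 0 < v < mdist (F x) (F y) ->
  exists2 z, L z & mdist (F x) (F z) = v.
Proof.
move=> Lx Ly /andP[v0 vd].
have cd : continuous (fun u : Y => mdist (F x) u).
  move=> u; apply/cvgrPdist_lt => e e0.
  have : nbhs u (ball u e) by exact: nbhsx_ballx.
  apply: filterS => w; rewrite ballEmdist /= => uw.
  have := metric_triangle (F x) u w; have := metric_triangle (F x) w u.
  by rewrite (metric_sym w u) ltr_norml => ? ?; apply/andP; lra.
pose E := K `&` F @^-1` [set u | mdist (F x) u = v].
have kE : compact E.
  apply: compact_preimage.
  have := @preimage_closed _ _ (fun u : Y => mdist (F x) u) [set v].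
  by apply => [u _|]; [exact: cd|exact: closed_eq].
suff [N NP] : exists N, forall n, (N <= n)%N -> Q n `&` E !=set0.
  have [z [Lz [Kz zv]]] := hausdorff_lim_compact QL limit_closed kE NP.
  by exists z.
have n1 : nbhs (F x) (ball (F x) v) by exact: nbhsx_ballx.
have n2 : nbhs (F y) (ball (F y) (mdist (F x) (F y) - v)).
  by apply: nbhsx_ballx; rewrite subr_gt0.
have [N1 N1P] := near_value Lx n1; have [N2 N2P] := near_value Ly n2.
exists (maxn N1 N2) => n; rewrite geq_max => /andP[/N1P[a Qa xa] /N2P[b Qb yb]].
move: xa yb; rewrite !ballEmdist /= => xa yb.
have /connected_intervalP iP : connected ((fun u => mdist (F x) u) @` (F @` Q n)).
  apply: connected_continuous_connected; first exact: image_connected.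
  exact: continuous_subspaceT.
have [_ [w Qw <-] wv] : ((fun u => mdist (F x) u) @` (F @` Q n)) v.
  apply: (iP (mdist (F x) (F a)) (mdist (F x) (F b))).
  - by exists (F a) => //; exists a.
  - by exists (F b) => //; exists b.
  have := metric_triangle (F x) (F b) (F y); rewrite (metric_sym (F b) (F y)).
  by move=> ?; apply/andP; lra.
by exists w; split => //; split => //; have [] := component_sub Qw.
Qed.

End MonotoneMaps.

(** * The Schönflies relation *)

Section Cells.
Context {R : realType}.

Lemma compact_modulus (E : set R) (h : R -> R) (e : R) : compact E ->
  {within E, continuous h} -> 0 < e ->
  exists2 k, 0 < k & forall s t, E s -> E t -> `|s - t| < k -> `|h s - h t| < e.
Proof.
move=> kE ch e0.
pose P (k s : R) := E s -> forall t, E t -> `|s - t| < k -> `|h s - h t| < e.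
have : \forall k \near (0 : R)^'+, E `<=` P k.
  move/compact_near_coveringP: kE => /(_ _ ((0 : R)^'+)); apply => s Es.
  move: ch => /subspace_continuousP /(_ s Es) /cvgrPdist_lt /(_ (e / 2)).
  rewrite divr_gt0 // => /(_ isT); rewrite /within /= => /nbhs_ballP[d /= d0 dP].
  exists (ball s (d / 2), [set k | k < d / 2]).
    split => /=; first by apply: nbhsx_ballx; rewrite divr_gt0.
    by apply: nbhs_right_lt; rewrite divr_gt0.
  move=> [s' k] /= [ss' kd] Es' t Et st.
  have h1 : `|h s - h s'| < e / 2.
    by apply: dP => //; apply: (lt_trans ss'); rewrite /=; lra.
  have h2 : `|h s - h t| < e / 2.
    apply: dP => //; rewrite /ball /= -(subrKA s').
    apply: (le_lt_trans (ler_normD _ _)).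
    by move: ss'; rewrite /ball /= => ss'; lra.
  rewrite -(subrKA (h s)) (le_lt_trans (ler_normD _ _)) // distrC; lra.
move=> nP; have [k [kP k0]] : exists k, E `<=` P k /\ 0 < k.
  by apply: (@filter_ex _ ((0 : R)^'+)); apply: filterI => //; exact: nbhs_right_gt.
by exists k => // s t Es Et; exact: kP.
Qed.

Definition of_sphere (s : sphere R) : plane R := if s is Some z then z else 0.

(** [G] is continuous on [K] only, so uniform continuity is drawn from the compact set [E] of
    parameters at which the curve is in [K], which also excludes infinity. *)
Lemma curve_modulus (gam : R -> sphere R) (K : set (plane R)) (G : plane R -> R)
    (e : R) : {within `[0, 1], continuous gam} -> compact K ->
  {within K, continuous G} -> 0 < e ->
  exists2 k, 0 < k & forall s t z w, 0 <= s <= 1 -> 0 <= t <= 1 -> K z -> K w ->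
    gam s = to_sphere z -> gam t = to_sphere w -> `|s - t| < k -> `|G z - G w| < e.
Proof.
move=> cg kK cG e0.
pose E := `[0, 1] `&` gam @^-1` (@to_sphere R @` K).
have clK := to_sphere_compact_closed kK.
have kE : compact E.
  have kI := @segment_compact R 0 1.
  by apply: compact_within_preimage => //; exact: compact_closed (@Rhausdorff R) kI.
have cof : {within @to_sphere R @` K, continuous of_sphere}.
  apply/subspace_continuousP => _ [z Kz <-] V Vz.
  apply: (@filterS _ _ _ (@to_sphere R @` V)).
    by move=> _ [w Vw <-].
  by apply: cvg_within; exact: one_point_compactification_some_nbhs.
have cE : {within E, continuous gam}.
  by apply: continuous_subspaceW cg => s [].
have ch : {within E, continuous (G \o (of_sphere \o gam))}.
  apply: (within_comp_continuous (B := K)) => //.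
    by apply: (within_comp_continuous cE cof) => _ [s [_ Ks] <-].
  by move=> _ [s [_ [z Kz zs]] <-]; rewrite /= -zs.
have [k k0 kP] := compact_modulus kE ch e0.
exists k => // s t z w s01 t01 Kz Kw gs gt st.
have := kP s t; rewrite /= gs gt; apply => //.
  by split => //; exists z.
by split => //; exists w.
Qed.

Lemma truncn_mul_lt (M : nat) (s t : R) : 0 <= s -> 0 <= t ->
  (Num.truncn (s * M.+1%:R) < Num.truncn (t * M.+1%:R))%N -> s < t.
Proof.
move=> s0 t0 st; have M0 : 0 < M.+1%:R :> R by rewrite ltr0n.
have sM : 0 <= s * M.+1%:R by rewrite mulr_ge0 // ltW.
have tM : 0 <= t * M.+1%:R by rewrite mulr_ge0 // ltW.
have /andP[_ s1] := truncn_itv sM; have /andP[t1 _] := truncn_itv tM.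
rewrite -(ltr_pM2r M0); apply: (lt_le_trans s1); apply: le_trans t1.
by rewrite ler_nat.
Qed.

Lemma truncn_mul_eq (M : nat) (s t : R) : 0 <= s -> 0 <= t ->
  Num.truncn (s * M.+1%:R) = Num.truncn (t * M.+1%:R) -> `|s - t| < M.+1%:R^-1.
Proof.
move=> s0 t0 st; have M0 : 0 < M.+1%:R :> R by rewrite ltr0n.
have sM : 0 <= s * M.+1%:R by rewrite mulr_ge0 // ltW.
have tM : 0 <= t * M.+1%:R by rewrite mulr_ge0 // ltW.
have /andP[s1 s2] := truncn_itv sM; have /andP[t1 t2] := truncn_itv tM.
rewrite -(ltr_pM2r M0) mulVf ?gt_eqF // -{1}(gtr0_norm M0) -normrM mulrBl ltr_norml.
rewrite st in s1 s2; set n := Num.truncn _ in s1 s2 t1 t2.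
have nE : n.+1%:R = n%:R + 1 :> R by rewrite natr1.
by rewrite nE in s2 t2; apply/andP; lra.
Qed.

End Cells.

(** * Related points have equal images *)

Section Main.
Context {R : realType} (Y : metricType R) (K : set (plane R)).

Lemma schonflies_rel_monotone (f : K -> Y) (x y : K) :
  compact K -> peano_compactum Y -> monotone_map f ->
  schonflies_rel x y -> f x = f y.
Proof.
move=> kK pY [cf fT fib] [->//|[J1 [J2 [U]]]].
move=> [[sJ1 sJ2] J12 [J1x J2y] [Ucomp Ubd] [Q [L [Qinj Qcomp QJ [kL QL] [Lx Ly]]]]].
apply: contrapT => fxy.
(* [f] extended to the plane by the default value [f x] off [K]. *)
pose F : plane R -> Y := valL_ (f x) f.
have Ff (k : K) : F (set_val k) = f k.
  by rewrite -[in RHS](valLK (f x) f).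
have cF : {within K, continuous F} by apply/subspace_valL_continuousP'.
have FK : F @` K = setT.
  apply/seteqP; split=> // v _; have : range f v by rewrite fT.
  by move=> [k _ <-]; exists (set_val k); [exact: set_valP|exact: Ff].
have Ffib v : connected (K `&` F @^-1` [set v]).
  have -> : K `&` F @^-1` [set v] = set_val @` (f @^-1` [set v]).
    apply/seteqP; split=> [z [Kz /= Fz]|_ [k /= fk <-]].
      exists (exist _ z (mem_set Kz)) => //=.
      by rewrite -Ff.
    by split; [exact: set_valP|rewrite /= Ff].
  apply: connected_continuous_connected; first exact: fib.
  exact/continuous_subspaceT/initial_continuous.
have [Ucc Uconn] : U `<=` ~` (J1 `|` J2) /\ connected U.
  case: Ucomp => s _ <-; split; first exact: connected_component_sub.
  exact: component_connected.
have UclJ s : closure U s -> ~ U s -> (J1 `|` J2) s.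
  by move=> clUs nUs; rewrite -Ubd; split => // /interior_subset.
(* A point of [U] that is not interior would be a boundary point, hence on one of the curves. *)
have oU : open U.
  rewrite openE => s Us; apply: contrapT => nUs.
  by apply: (Ucc _ Us); rewrite -Ubd; split => //; exact: subset_closure.
pose D := @to_sphere R @^-1` closure U; pose W := @to_sphere R @^-1` U.
have clD : closed D.
  apply: preimage_closed; last exact: closed_closure.
  by move=> z _; exact: to_sphere_continuous.
have oW : open W by apply: open_comp => // z _; exact: to_sphere_continuous.
have WD : W `<=` D by move=> z Uz; exact: (@subset_closure _ U _ Uz).
have [gam gamP] : exists gam : bool -> R -> sphere R, forall c,
    [/\ {within `[0, 1], continuous (gam c)}, gam c 0 = gam c 1,
      {in `[0, 1[ &, injective (gam c)} &
      (if c then J1 else J2) = gam c @` `[0, 1]].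
  have [g1 g1P] := sJ1; have [g2 g2P] := sJ2.
  by exists (fun c => if c then g1 else g2); case.
have param s : (J1 `|` J2) s -> exists c t, [/\ 0 <= t, t < 1 & gam c t = s].
  have main c : (if c then J1 else J2) s -> exists c t, [/\ 0 <= t, t < 1 & gam c t = s].
    have [_ g01 _ ->] := gamP c; move=> [t /=]; rewrite in_itv /= => /andP[t0 t1] ts.
    exists c; have [t1'|t1'] := ltP t 1; first by exists t.
    by exists 0; split => //; rewrite g01 -ts; congr (gam c); lra.
  by case=> [/(main true)|/(main false)].
pose z0 := set_val x; pose z1 := set_val y.
have Fz01 : F z0 != F z1 by rewrite !Ff; apply/eqP.
pose d := mdist (F z0) (F z1); have d0 : 0 < d by rewrite mdist_gt0.
pose G z := mdist (F z0) (F z).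
have cG : {within K, continuous G}.
  apply/subspace_continuousP => z Kz; apply/cvgrPdist_lt => e e0.
  have /subspace_continuousP/(_ z Kz)/metricType_numDomainType.cvgrPdist_lt/(_ e e0) := cF.
  apply: filterS => w; rewrite /from_subspace => zw.
  have := metric_triangle (F z0) (F z) (F w); have := metric_triangle (F z0) (F w) (F z).
  by rewrite (metric_sym (F w) (F z)) /G ltr_norml => ? ?; apply/andP; lra.
(* Two approximations and one oscillation along a cell cost at most 3 e = 3 d / 20, less than the
   gap d / 6 between the five values [v i]. *)
pose e := d / 20; have e0 : 0 < e by rewrite divr_gt0.
pose v (i : 'I_5) : R := d * (i.+1%:R / 6).
have v_gap (i j : 'I_5) : i != j -> d / 6 <= `|v i - v j|.
  have aux (p q : 'I_5) : (p < q)%N -> d / 6 <= v q - v p.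
    move=> pq; have : p.+2%:R <= q.+1%:R :> R by rewrite ler_nat.
    rewrite -natr1 => /(ler_wpM2l (ltW d0)); rewrite /v; lra.
  move=> ij; have [/aux h|/aux h|/val_inj ije] := ltngtP i j.
  - by rewrite distrC (le_trans h) // ler_norm.
  - by rewrite (le_trans h) // ler_norm.
  - by rewrite ije eqxx in ij.
have /boolp.choice[N0 N0P] : forall i : 'I_5, exists N, forall n, (N <= n)%N ->
    exists2 w, Q n w & ~ W w /\ `|v i - G w| <= e.
  move=> i; have vi : 0 < v i < d.
    rewrite /v mulr_gt0 ?divr_gt0 ?ltr0n //= -[ltRHS]mulr1 ltr_pM2l //.
    by rewrite ltr_pdivrMr ?ltr0n // mul1r ltr_nat ltnS ltn_ord.
  have [z Lz zv] := intermediate_value kK cF Qcomp kL QL Lx Ly vi.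
  have [N NP] := escape_near_value kK cF FK Ffib pY clD oW WD Qinj Qcomp QL
    Lx Ly Fz01 Lz e0.
  exists N => n /NP[w Qw [nW zw]]; exists w => //; split => //.
  have := metric_triangle (F z0) (F z) (F w); have := metric_triangle (F z0) (F w) (F z).
  rewrite (metric_sym (F w) (F z)) /G -zv ler_norml => ? ?; apply/andP; lra.
pose N := (\max_(i < 5) N0 i)%N.
have NP n i : (N <= n)%N -> exists2 w, Q n w & ~ W w /\ `|v i - G w| <= e.
  by move=> Nn; apply: N0P; apply: leq_trans Nn; exact: leq_bigmax.
have /boolp.choice[w wP] : forall p : nat * 'I_5, exists w : bool * R * plane R,
    [/\ Q (N + p.1)%N w.2, 0 <= w.1.2, w.1.2 < 1, gam w.1.1 w.1.2 = to_sphere w.2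
    & `|v p.2 - G w.2| <= e].
  move=> [n i] /=; have [z Qz [nWz zv]] := NP (N + n)%N i (leq_addr _ _).
  have Dz : D z by have [] := component_sub Qcomp Qz.
  have [c [t [t0 t1 tz]]] := param _ (UclJ _ Dz nWz).
  by exists (c, t, z).
have QK n z : Q n z -> K z by move=> /(component_sub Qcomp)[].
have [k k0 kP] : exists2 k, 0 < k & forall c s t z w, 0 <= s <= 1 -> 0 <= t <= 1 ->
    K z -> K w -> gam c s = to_sphere z -> gam c t = to_sphere w ->
    `|s - t| < k -> `|G z - G w| < e.
  have [k1 k10 k1P] : exists2 k, 0 < k & forall s t z w, 0 <= s <= 1 ->
      0 <= t <= 1 -> K z -> K w -> gam true s = to_sphere z ->
      gam true t = to_sphere w -> `|s - t| < k -> `|G z - G w| < e.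
    by apply: curve_modulus => //; have [] := gamP true.
  have [k2 k20 k2P] : exists2 k, 0 < k & forall s t z w, 0 <= s <= 1 ->
      0 <= t <= 1 -> K z -> K w -> gam false s = to_sphere z ->
      gam false t = to_sphere w -> `|s - t| < k -> `|G z - G w| < e.
    by apply: curve_modulus => //; have [] := gamP false.
  exists (Num.min k1 k2); first by rewrite lt_min k10.
  move=> c s t z z' s01 t01 Kz Kz' gs gt; rewrite lt_min => /andP[h1 h2].
  by case: c gs gt => gs gt; [exact: (k1P s t)|exact: (k2P s t)].
pose M := Num.truncn k^-1.
have Mk : M.+1%:R^-1 < k.
  rewrite -[ltRHS]invrK ltf_pV2 ?posrE ?invr_gt0 // ?ltr0n //.
  by have /andP[] : M%:R <= k^-1 < M.+1%:R by apply: truncn_itv; rewrite invr_ge0 ltW.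
pose cell (t : R) := Num.truncn (t * M.+1%:R).
have cell_lt t : 0 <= t -> t < 1 -> (cell t < M.+1)%N.
  move=> t0 t1; rewrite truncn_lt_nat; last by rewrite mulr_ge0.
  by rewrite -[ltRHS]mul1r ltr_pM2r ?ltr0n.
(* The pattern of the [n]-th component: for each of the five values, the curve and the cell in which
   it is nearly taken. The cells play the role of the disjoint arcs. *)
pose key n := [ffun i => ((w (n, i)).1.1, inord (cell (w (n, i)).1.2) : 'I_M.+1)].
have [n [m [nm knm]]] : exists n m, n != m /\ key n = key m.
  pose T := {ffun 'I_5 -> bool * 'I_M.+1}.
  pose kk (n : 'I_#|T|.+1) : T := key n.
  have /injectivePn[n [m nm knm]] : ~~ injectiveb kk.
    by apply/negP => /injectiveP/leq_card; rewrite card_ord ltnn.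
  by exists (nat_of_ord n), (nat_of_ord m).
have same i : (w (n, i)).1.1 = (w (m, i)).1.1 /\ cell (w (n, i)).1.2 = cell (w (m, i)).1.2.
  have := congr1 (fun h : {ffun 'I_5 -> bool * 'I_M.+1} => h i) knm.
  rewrite !ffunE => -[-> /(congr1 val)].
  have [_ n0 n1 _ _] := wP (n, i); have [_ m0 m1 _ _] := wP (m, i).
  by rewrite /= !inordK ?cell_lt.
have Qnm : Q (N + n)%N `&` Q (N + m)%N = set0.
  by apply: (components_disjoint Qinj Qcomp); rewrite eqn_add2l.
have no_triple i j l : (w (n, i)).1.1 = (w (n, j)).1.1 ->
    (w (n, j)).1.1 = (w (n, l)).1.1 ->
    (cell (w (n, i)).1.2 < cell (w (n, j)).1.2)%N ->
    (cell (w (n, j)).1.2 < cell (w (n, l)).1.2)%N -> False.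
  move=> cij cjl ij jl.
  have [ci si] := same i; have [cj sj] := same j; have [cl sl] := same l.
  have [Qni ni0 ni1 gni _] := wP (n, i); have [Qmi mi0 mi1 gmi _] := wP (m, i).
  have [Qnj nj0 nj1 gnj _] := wP (n, j); have [Qmj mj0 mj1 gmj _] := wP (m, j).
  have [Qnl nl0 nl1 gnl _] := wP (n, l); have [Qml ml0 ml1 gml _] := wP (m, l).
  rewrite -ci in gmi; rewrite -cj -cij in gmj; rewrite -cl -cjl -cij in gml.
  rewrite -cij in gnj; rewrite -cjl -cij in gnl.
  have [cgam g01 gi gJ] := gamP (w (n, i)).1.1.
  have UJ : U `&` (gam (w (n, i)).1.1 @` `[0, 1]) = set0.
    rewrite -gJ; apply/seteqP; split => // s [Us Js]; apply: (Ucc _ Us).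
    by case: ((w (n, i)).1.1) Js; [left|right].
  have QU p : @to_sphere R @` Q p `<=` closure U.
    by move=> _ [z Qz <-]; have [] := component_sub Qcomp Qz.
  have clt s t : 0 <= s -> 0 <= t -> (cell s < cell t)%N -> s < t.
    exact: truncn_mul_lt.
  apply: (@sphere_no_three_crossings _ (gam (w (n, i)).1.1) U (Q (N + n)%N) (Q (N + m)%N)
    (w (n, i)).1.2 (w (m, i)).1.2 (w (n, j)).1.2 (w (m, j)).1.2
    (w (n, l)).1.2 (w (m, l)).1.2) => //.
  - exact: (components_compact kK clD Qcomp).
  - exact: (components_connected Qcomp).
  - exact: (components_compact kK clD Qcomp).
  - exact: (components_connected Qcomp).
  - by apply: clt => //; rewrite -?si -?sj -?sl.
  - by apply: clt => //; rewrite -?si -?sj -?sl.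
  - by apply: clt => //; rewrite -?si -?sj -?sl.
  - by apply: clt => //; rewrite -?si -?sj -?sl.
  - by apply: clt => //; rewrite -?si -?sj -?sl.
  - by apply: clt => //; rewrite -?si -?sj -?sl.
  - by apply: clt => //; rewrite -?si -?sj -?sl.
  - by apply: clt => //; rewrite -?si -?sj -?sl.
  - by rewrite gni; exists (w (n, i)).2.
  - by rewrite gnj; exists (w (n, j)).2.
  - by rewrite gnl; exists (w (n, l)).2.
  - by rewrite gmi; exists (w (m, i)).2.
  - by rewrite gmj; exists (w (m, j)).2.
  - by rewrite gml; exists (w (m, l)).2.
have cell_neq i j : i != j -> (w (n, i)).1.1 = (w (n, j)).1.1 ->
    cell (w (n, i)).1.2 <> cell (w (n, j)).1.2.
  move=> ij cij sij.
  have [Qni ni0 ni1 gni vi] := wP (n, i); have [Qnj nj0 nj1 gnj vj] := wP (n, j).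
  have st := lt_trans (truncn_mul_eq ni0 nj0 sij) Mk.
  rewrite -cij in gnj.
  have := kP _ _ _ _ _ _ _ (QK _ _ Qni) (QK _ _ Qnj) gni gnj st.
  rewrite ni0 nj0 !ltW // => /(_ isT isT) Gij.
  have := v_gap i j ij; rewrite leNgt => /negP; apply.
  move: vi vj Gij; rewrite /= /e !ler_norml !ltr_norml => /andP[? ?] /andP[? ?] /andP[? ?].
  by apply/andP; lra.
pose A (c : bool) := [pred i : 'I_5 | (w (n, i)).1.1 == c].
(* Five indices on two curves: one curve carries at least three. *)
have : (2 < #|A true|)%N || (2 < #|A false|)%N.
  have := cardC (A true); rewrite card_ord.
  rewrite (_ : #|[predC A true]| = #|A false|); last first.
    by apply: eq_card => i; rewrite !inE; case: (_.1.1).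
  by case: (#|A true|) (#|A false|) => [|[|[|p]]] [|[|[|q]]].
move=> A3; have [c Ac] : exists c, (2 < #|A c|)%N.
  by case/orP: A3 => ?; [exists true|exists false].
have /card_gt2P[i [j [l [[iA jA lA] [ij jl li]]]]] := Ac.
have eqc p q : p \in A c -> q \in A c -> (w (n, p)).1.1 = (w (n, q)).1.1.
  by rewrite !inE => /eqP -> /eqP ->.
have nij := cell_neq _ _ ij (eqc _ _ iA jA).
have njl := cell_neq _ _ jl (eqc _ _ jA lA).
have nli := cell_neq _ _ li (eqc _ _ lA iA).
have no3 p q r : p \in A c -> q \in A c -> r \in A c ->
    (cell (w (n, p)).1.2 < cell (w (n, q)).1.2)%N ->
    (cell (w (n, q)).1.2 < cell (w (n, r)).1.2)%N -> False.
  by move=> pA qA rA; apply: no_triple; exact: eqc.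
case: (ltngtP (cell (w (n, i)).1.2) (cell (w (n, j)).1.2)) => // cij;
case: (ltngtP (cell (w (n, j)).1.2) (cell (w (n, l)).1.2)) => // cjl;
case: (ltngtP (cell (w (n, l)).1.2) (cell (w (n, i)).1.2)) => // cli.
- exact: (no3 i j l).
- exact: (no3 i j l).
- exact: (no3 l i j).
- exact: (no3 i l j).
- exact: (no3 j l i).
- exact: (no3 j i l).
- exact: (no3 l j i).
- exact: (no3 l j i).
Qed.

End Main.

(** Equality of [f]-values is an equivalence, closed by continuity of [f], and it contains the
    Schönflies relation; by minimality it contains the Schönflies equivalence. So [f] descends, and
    the quotient topology makes the descended map continuous. *)
Theorem theorem6 (R : realType) (K : set (plane R)) (Y : metricType R)
    (f : K -> Y) :
  compact K -> peano_compactum Y -> monotone_map f ->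
  exists g : schonflies_quotient K -> Y,
    [/\ continuous g, range g = [set: Y] & f = g \o @schonflies_pi R K].
Proof.
move=> kK pY mf; have [cf fT _] := mf.
pose e (x y : K) := `[< f x = f y >].
have eE : equiv_class_of e.
  split=> [x|x y|y x z].
  - exact/asboolP.
  - by apply/asboolP/asboolP.
  - by move=> /asboolP xy /asboolP yz; apply/asboolP; rewrite xy.
have ef (x y : K) : schonflies_equiv K x y -> f x = f y.
  move=> xy; apply/asboolP.
  apply: (@schonflies_eq_min _ K (EquivRelPack eE) _ _ x y xy) => [|a b ab].
    move=> p clp; apply/asboolP; apply: contrapT => /eqP; rewrite -mdist_gt0 => d0.
    (* Balls of half the distance about the two images are disjoint, so no pair with equal images is
       near [p]. *)
    have bn (z : K) : nbhs z (f @^-1` ball (f z) (mdist (f p.1) (f p.2) / 2)).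
      by apply: cf; apply: nbhsx_ballx; rewrite divr_gt0.
    pose B (z : K) := f @^-1` ball (f z) (mdist (f p.1) (f p.2) / 2).
    have nB : nbhs p (B p.1 `*` B p.2) by exists (B p.1, B p.2) => //; split; exact: bn.
    have [q [/asboolP q12 []]] := clp _ nB; rewrite /B /= !ballEmdist /= q12.
    have := metric_triangle (f p.1) (f q.2) (f p.2); rewrite (metric_sym (f q.2) (f p.2)).
    by lra.
  by apply/asboolP; exact: schonflies_rel_monotone ab.
have fpi (x y : K) : schonflies_pi x = schonflies_pi y -> f x = f y.
  by move=> /eqmodP /ef.
have fK : f = (f \o repr) \o @schonflies_pi R K.
  by apply/funext => x /=; apply: fpi; rewrite /schonflies_pi reprK.
exists (f \o repr); split => //.
- apply: repr_comp_continuous => // x y /eqP xy; apply/eqP; exact: fpi.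
- apply/seteqP; split => // y _; have : range f y by rewrite fT.
  by move=> [x _ <-]; exists (schonflies_pi x) => //; rewrite [in RHS]fK.
Qed.
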